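(* Let $\kappa>0$ and $D_\kappa=\pi/\sqrt{\kappa}$. Let $(C,\rho)$ be a complete CAT($\kappa$) space with the N-property and with diameter smaller than $D_\kappa/2$. Let $T\colon C\to C$ be a nonexpansive mapping with $\mathrm{Fix}\,T\neq\emptyset$. Let $M\in(0,\pi/2)$ be a fixed number and let $f\colon C\to C$ be a $k$-contraction with $$k<\frac{2\sin^2\frac{M}{2}\,\cos M}{M^2}$$ and such that $\rho(p,f(p))\le M/(4\sqrt{\kappa})$ for all $p\in\mathrm{Fix}\,T$. Then there is a unique fixed point $q\in\mathrm{Fix}\,T$ for which $$P_{\mathrm{Fix}\,T}(f(q))=q.$$ Moreover, for each point $u\in C$ such that $\rho(u,q)\le M/(4\sqrt{\kappa})$ and for each pair of real sequences $(b_n)_{n\ge1}$, $(t_n)_{n\ge1}$ satisfying (i) $b_n,t_n\in(0,1)$ for all $n\in\mathbb{N}$; (ii) $0<\liminf_{n\to\infty} b_n\le\limsup_{n\to\infty} b_n<1$; (iii) $\lim_{n\to\infty}t_n=0$; (iv) $\sum_{n=1}^\infty t_n=\infty$, the sequence $(x_n)$ defined by $$x_1=u,\qquad y_n=t_nf(x_n)+(1-t_n)T(x_n),\qquad x_{n+1}=b_nx_n+(1-b_n)y_n\quad(n\ge1)$$ converges to $q$.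
   Context: For $\kappa>0$ the model space $M_\kappa^2$ is the unit sphere $\mathbb{S}^2$ with the spherical distance multiplied by $1/\sqrt{\kappa}$. A CAT($\kappa$) space is a geodesic metric space $(X,\rho)$ in which every geodesic triangle of perimeter less than $2D_\kappa$ satisfies $\rho(y_1,y_2)\le d(\bar y_1,\bar y_2)$ for all points $y_1,y_2$ on it and their comparison points $\bar y_1,\bar y_2$ on the comparison triangle in $M_\kappa^2$ (with metric $d$). Points at distance less than $D_\kappa$ are joined by a unique geodesic segment $[x,y]$; for $\alpha\in(0,1)$, $\alpha x+(1-\alpha)y$ denotes the point $z$ of $[x,y]$ with $\rho(x,z)=(1-\alpha)\rho(x,y)$ and $\rho(z,y)=\alpha\rho(x,y)$. A set $S$ is $D_\kappa$-convex if $[x,y]\subset S$ for all $x,y\in S$ with $\rho(x,y)<D_\kappa$. For a nonempty closed $D_\kappa$-convex subset $S$ of a complete CAT($\kappa$) space and a point $x$ with $\rho(x,S)=\inf_{s\in S}\rho(x,s)<D_\kappa/2$, $P_S(x)$ denotes the (unique) point of $S$ nearest to $x$. N-property: a CAT($\kappa$) space $X$ has the N-property if for every (nonempty) closed $D_\kappa$-convex set $S\subset X$ and all $x_1,x_2\in X$ with $\rho(x_i,S)<D_\kappa/2$, $\rho(x_1,x_2)<D_\kappa/2$ and $P_S(x_1)=P_S(x_2)=P$, one has $P_S(\alpha x_1+(1-\alpha)x_2)=P$ for every $\alpha\in(0,1)$. $T$ is nonexpansive if $\rho(Tx,Ty)\le\rho(x,y)$ for all $x,y$; $\mathrm{Fix}\,T=\{x: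 Tx=x\}$. $f$ is a $k$-contraction (with $0\le k<1$) if $\rho(f(x),f(y))\le k\rho(x,y)$ for all $x,y$. *)

(* Defs.v *)
From HB Require Import structures.
From mathcomp Require Import all_boot all_order all_algebra.
From mathcomp Require Import all_classical all_reals all_analysis.

Set Implicit Arguments.
Unset Strict Implicit.
Unset Printing Implicit Defensive.

Import Order.TTheory GRing.Theory Num.Theory.
Import numFieldNormedType.Exports.

Local Open Scope classical_set_scope.
Local Open Scope ring_scope.

#[short(type="completeMetricType")]
HB.structure Definition CompleteMetric (R : realType) :=
  {C of CompletePseudoMetric R C & Metric R C}.

(** The notions of this section only need a distance function [d], so that they
    apply both to a [metricType] and to the model space. *)
Section geodesics.
Context {R : realType} {X : Type} (d : X -> X -> R).

Definition geodesic_path (g : R -> X) (x y : X) : Prop :=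
  [/\ g 0 = x, g (d x y) = y &
      forall s t, 0 <= s <= d x y -> 0 <= t <= d x y -> d (g s) (g t) = `|s - t|].

Definition geodesic_space : Prop :=
  forall x y : X, exists g, geodesic_path g x y.

(** [ordS] is the cyclic successor, so the three sides are
    [v 0, v 1], [v 1, v 2] and [v 2, v 0]. *)
Definition geodesic_triangle (v : 'I_3 -> X) (g : 'I_3 -> R -> X) : Prop :=
  forall i, geodesic_path (g i) (v i) (v (ordS i)).

Definition side_length (v : 'I_3 -> X) (i : 'I_3) : R := d (v i) (v (ordS i)).

Definition perimeter (v : 'I_3 -> X) : R := \sum_(i < 3) side_length v i.

End geodesics.

Section model_space.
Context {R : realType}.

Definition dotv (u v : 'rV[R]_3) : R := \sum_(i < 3) u 0 i * v 0 i.

Definition sphere2 : Type := {v : 'rV[R]_3 | dotv v v = 1}.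

Definition model_dist (kappa : R) (u v : sphere2) : R :=
  acos (dotv (sval u) (sval v)) / Num.sqrt kappa.

Definition model_diam (kappa : R) : R := pi / Num.sqrt kappa.

End model_space.

Section cat_spaces.
Context {R : realType}.

(** A point of the [i]-th side is [g i s] with [0 <= s <= side_length mdist v i];
    it lies at distance [s] from [v i], so its comparison point, which lies on
    the corresponding side at the same distance from [w i], is [h i s]. *)
Definition CAT (kappa : R) (X : metricType R) : Prop :=
  geodesic_space (@mdist R X) /\
  forall (v : 'I_3 -> X) (g : 'I_3 -> R -> X)
         (w : 'I_3 -> @sphere2 R) (h : 'I_3 -> R -> @sphere2 R),
    geodesic_triangle (@mdist R X) v g ->
    perimeter (@mdist R X) v < 2 * model_diam kappa ->
    geodesic_triangle (model_dist kappa) w h ->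
    (forall i, side_length (model_dist kappa) w i = side_length mdist v i) ->
    forall (i j : 'I_3) (s t : R),
      0 <= s <= side_length mdist v i -> 0 <= t <= side_length mdist v j ->
      mdist (g i s) (g j t) <= model_dist kappa (h i s) (h j t).

Section metric_notions.
Context {X : metricType R}.

(** The union of all geodesic segments from [x] to [y]; in a CAT([kappa]) space
    there is only one when [mdist x y < model_diam kappa]. *)
Definition segment (x y : X) : set X :=
  [set z | exists g s,
    [/\ geodesic_path mdist g x y, 0 <= s <= mdist x y & z = g s]].

(** The point [a x + (1 - a) y]. *)
Definition geocomb (a : R) (x y : X) : X :=
  xget x [set z | [/\ segment x y z, mdist x z = (1 - a) * mdist x y
                    & mdist z y = a * mdist x y]].

Definition D_convex (kappa : R) (S : set X) : Prop :=
  forall x y, S x -> S y -> mdist x y < model_diam kappa -> segment x y `<=` S.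

(** Meaningful for nonempty [S] only. *)
Definition dist_to (x : X) (S : set X) : R := inf [set mdist x s | s in S].

(** A nearest point of [S] to [x], and [x] itself when there is none; nearest
    points exist and are unique when [S] is a nonempty closed [D_convex] subset
    of a complete CAT([kappa]) space and [dist_to x S < model_diam kappa / 2]. *)
Definition metric_proj (S : set X) (x : X) : X :=
  xget x [set p | S p /\ mdist x p = dist_to x S].

Definition fixpts (T : X -> X) : set X := [set x | T x = x].

Definition nonexpansive (T : X -> X) : Prop :=
  forall x y, mdist (T x) (T y) <= mdist x y.

Definition contraction_with (k : R) (f : X -> X) : Prop :=
  0 <= k < 1 /\ forall x y, mdist (f x) (f y) <= k * mdist x y.

End metric_notions.

Definition diameter (X : metricType R) : \bar R :=
  ereal_sup [set (mdist p.1 p.2)%:E | p in [set: X * X]].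

Definition N_property (kappa : R) (X : metricType R) : Prop :=
  forall S : set X, S !=set0 -> closed S -> D_convex kappa S ->
  forall x1 x2 p : X,
    dist_to x1 S < model_diam kappa / 2 ->
    dist_to x2 S < model_diam kappa / 2 ->
    mdist x1 x2 < model_diam kappa / 2 ->
    metric_proj S x1 = p -> metric_proj S x2 = p ->
    forall a : R, 0 < a < 1 -> metric_proj S (geocomb a x1 x2) = p.

End cat_spaces.

(* Main.v *)
Require Import Defs.
From mathcomp Require Import all_boot all_order all_algebra.
From mathcomp Require Import all_classical all_reals all_analysis.
From mathcomp Require Import ring lra.

Set Implicit Arguments.
Unset Strict Implicit.
Unset Printing Implicit Defensive.

Import Order.TTheory GRing.Theory Num.Theory.
Import numFieldNormedType.Exports.

Local Open Scope classical_set_scope.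
Local Open Scope ring_scope.

(** Distances are measured as central angles [A x y] of the model sphere, all of
    which are bounded away from [pi / 2].  The curvature bound is used only
    through [CAT_cos]: along a segment, the cosine of the distance to any point
    is at least its spherical interpolation.  From it follow the inequalities
    that replace the inner product of the Hilbert space proof, with cosines in
    the role of inner products of unit vectors: the first-order expansion
    [comb_cos_slope], and the Cauchy-Schwarz inequality [four_point].

    The points displaced by at most [e] by a nonexpansive [T] form a set that is
    convex up to a loss that vanishes with [e] ([approx_fix_comb]).  Hence the
    classical proof that a closed convex set contains a nearest point, applied
    to all these sets at once, gives for each [u] a fixed point [q] that no
    almost fixed point can beat by much as an approximation of [u].  A small
    displacement of [q] towards an almost fixed point [x] stays almost fixed,
    so the angle of [u q x] at [q] is almost right or obtuse: this is [foot].
    It plays the part that weak compactness and demiclosedness play in Hilbert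
    space, and it identifies [q] as the projection of [u].

    The bound on the contraction constant gives [k <= 1 / 2], because
    [sin (M / 2) <= M / 2] and [cos M <= 1].  Near the fixed point set (within
    [pi / 8], since [M < pi / 2]) the projection expands distances by a factor
    of at most [9 / 5] ([foot_lipschitz]), so its composite with [f] is a
    contraction of the fixed point set, and has a unique fixed point [q]
    ([viscosity_exists], [viscosity_unique]).

    For the iteration, consider [s n = 1 - cos (A (x n) q)].  It increases by at
    most [2 * t n] at each step.  While [s n >= e], it decreases by at least a
    fixed multiple of [t n] for large [n], for one of two reasons.  If [x n] is
    far from [y n], averaging the two gains a fixed amount ([step_average]),
    which exceeds any multiple of [t n] in the long run.  Otherwise [x n] is
    almost fixed; the right angle at [q] together with the contractivity of [f]
    then makes the angle at [x n] between [q] and [f (x n)] acute, so that the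
    step towards [f (x n)] approaches [q] ([step_attract]).  As the [t n] tend
    to [0] and have a divergent sum, [s] tends to [0] ([divergent_descent]). *)

(** * Trigonometric estimates *)
Section trigonometry.
Context {R : realType}.
Implicit Types x y a l : R.

Lemma sin_MVT x y : x <= y ->
  exists2 c, x <= c <= y & sin y - sin x = cos c * (y - x).
Proof.
move=> xy.
have D z : z \in `]x, y[ -> is_derive z 1 sin (cos z).
  by move=> _; exact: is_derive_sin.
have [c] := MVT_segment xy D (continuous_subspaceT (@continuous_sin R)).
by rewrite in_itv /= => cxy ->; exists c.
Qed.

Lemma cos_MVT x y : x <= y ->
  exists2 c, x <= c <= y & cos y - cos x = - sin c * (y - x).
Proof.
move=> xy.
have D z : z \in `]x, y[ -> is_derive z 1 cos (- sin z).
  by move=> _; exact: is_derive_cos.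
have [c] := MVT_segment xy D (continuous_subspaceT (@continuous_cos R)).
by rewrite in_itv /= => cxy ->; exists c.
Qed.

Lemma cos_anti x y : 0 <= x -> x <= y -> y <= pi -> cos y <= cos x.
Proof.
move=> x0 xy ypi; have [c /andP[xc cy] E] := cos_MVT xy.
have s0 : 0 <= sin c by apply: sin_ge0_pi; lra.
by nra.
Qed.

Lemma cos_inj_le x y : 0 <= x <= pi -> 0 <= y <= pi -> cos y <= cos x -> x <= y.
Proof.
move=> xi yi; rewrite leNgt => h; rewrite leNgt; apply: contra h => yx.
by rewrite ltr_cos.
Qed.

Lemma sin_mono x y : 0 <= x -> x <= y -> y <= pi / 2 -> sin x <= sin y.
Proof.
move=> x0 xy yp; have [c /andP[xc cy] E] := sin_MVT xy.
have s0 : 0 <= cos c by apply: cos_ge0_pihalf; lra.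
by nra.
Qed.

(** The cosine is 1-Lipschitz; the form below is the one that fits a triangle
    inequality [x <= y + e]. *)
Lemma cos_lip x y e : 0 <= y -> x <= pi -> 0 <= e -> x <= y + e ->
  0 <= x -> y <= pi -> cos y - e <= cos x.
Proof.
move=> y0 xpi e0 xye x0 ypi; have [xy|yx] := leP x y.
  by have := cos_anti x0 xy ypi; lra.
have [c /andP[yc cx] E] := cos_MVT (ltW yx).
have := sin_le1 c; have : 0 <= sin c by apply: sin_ge0_pi; lra.
by move: E; nra.
Qed.

Lemma sin_lex x : 0 <= x -> sin x <= x.
Proof.
move=> x0; have [c /andP[xc cy] E] := sin_MVT x0.
by move: E; rewrite sin0; have := cos_le1 c; nra.
Qed.

Lemma sin_gex x : 0 <= x <= pi / 2 -> x * cos x <= sin x.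
Proof.
move=> /andP[x0 x1]; have [c /andP[xc cy] E] := sin_MVT x0.
have : cos x <= cos c by apply: cos_anti => //; have := pi_gt0 R; lra.
by move: E; rewrite sin0; nra.
Qed.

Lemma sin_half x : sin x = 2 * sin (x / 2) * cos (x / 2).
Proof. by rewrite {1}(splitr x) sinD; ring. Qed.

Lemma cos_half x : cos x = 1 - 2 * sin (x / 2) ^+ 2.
Proof. by rewrite {1}(splitr x) cosD -!expr2 cos2sin2; ring. Qed.

Lemma cos_half_cos x : cos x = 2 * cos (x / 2) ^+ 2 - 1.
Proof. by rewrite {1}(splitr x) cosD -!expr2 sin2cos2; ring. Qed.

Lemma cos_pi4 : cos (pi / 4) ^+ 2 = 1 / 2 :> R.
Proof.
have := cos_half_cos (pi / 2); rewrite cos_pihalf.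
have -> : pi / 2 / 2 = pi / 4 :> R by lra.
by lra.
Qed.

Lemma cos_pi4_ge : 7/10 <= cos (pi / 4) :> R.
Proof.
have := cos_pi4; have := @pi_gt0 R.
have : 0 <= cos (pi / 4) :> R.
  by apply: cos_ge0_pihalf; have := @pi_gt0 R; lra.
by nra.
Qed.

Lemma cos_ge_pi4 x : 0 <= x <= pi / 4 -> 7/10 <= cos x.
Proof.
move=> /andP[x0 x1]; apply: (le_trans cos_pi4_ge).
by apply: cos_anti => //; have := @pi_gt0 R; lra.
Qed.

Lemma cos_ge_pi8 x : 0 <= x <= pi / 8 -> 92/100 <= cos x.
Proof.
move=> /andP[x0 x1].
have c0 : 0 <= cos x by apply: cos_ge0_pihalf; have := @pi_gt0 R; lra.
have : 7/10 <= cos (x + x) by apply: cos_ge_pi4; lra.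
have := cos_half_cos (x + x).
have -> : (x + x) / 2 = x by lra.
by nra.
Qed.

Lemma cos_upper x : 0 <= x -> 1 - x ^+ 2 / 2 <= cos x.
Proof.
move=> x0; rewrite cos_half; set y := x / 2.
have -> : x = 2 * y by rewrite /y; lra.
have y0 : 0 <= y by rewrite /y; lra.
have [yp|yp] := leP y (pi / 2).
  have h1 : 0 <= sin y by apply: sin_ge0_pi; have := @pi_gt0 R; lra.
  by have := sin_lex y0; nra.
have := sin_le1 y; have := sin_geN1 y; have := @pihalf_ge1 R.
by nra.
Qed.

Lemma cos_lower x : 0 <= x <= pi / 2 -> cos x <= 1 - x ^+ 2 / 5.
Proof.
move=> /andP[x0 x1]; rewrite cos_half; set y := x / 2.
have -> : x = 2 * y by rewrite /y; lra.
have y0 : 0 <= y <= pi / 4 by rewrite /y; lra.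
have := cos_ge_pi4 y0.
have : y * cos y <= sin y by apply: sin_gex; have := @pi_gt0 R; lra.
move=> h1 h2; have : 0 <= y * (7/10) <= sin y by nra.
by nra.
Qed.

(** Jordan-type bound: halving the angle twice gives
    [sin x >= x * cos (x / 4) ^+ 2 * cos (x / 2)]. *)
Lemma sin_jordan x : 0 <= x <= pi / 2 -> 59/100 * x <= sin x.
Proof.
move=> /andP[x0 x1]; rewrite sin_half (sin_half (x / 2)).
set y := x / 2 / 2; have -> : x / 2 = y + y by rewrite /y; lra.
have -> : x = 4 * y by rewrite /y; lra.
have y0 : 0 <= y <= pi / 8 by rewrite /y; lra.
have c2y : cos (y + y) = 2 * cos y ^+ 2 - 1.
  by rewrite cosD -!expr2 sin2cos2; ring.
have : y * cos y <= sin y by apply: sin_gex; have := @pi_gt0 R; lra.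
have h7 : 7/10 <= cos (y + y) by apply: cos_ge_pi4; lra.
have : 85/100 <= cos y ^+ 2 by lra.
have h9 := cos_ge_pi8 y0.
have sy : 0 <= sin y by apply: sin_ge0_pi; have := @pi_gt0 R; lra.
move: (sin y) (cos y) (cos (y + y)) sy h7 h9 {c2y x0 x1} y0 => s c d s0 d7 c9
  /andP[y0 _] c85 ys.
have sc : 85/100 * y <= s * c by nra.
 have : (s * c) * (7/10) <= s * c * d by apply: ler_wpM2l => //; nra.
by lra.
Qed.

Lemma sin_concave a x : 0 <= a <= 1 -> 0 <= x <= pi / 2 ->
  a * sin x <= sin (a * x).
Proof.
move=> /andP[a0 a1] /andP[x0 x1].
have ax0 : 0 <= a * x by nra.
have axx : a * x <= x by nra.
have [c /andP[c0 ca] E] := sin_MVT ax0.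
have [d /andP[da dx] D] := sin_MVT axx.
have : cos d <= cos c by apply: cos_anti; lra.
move: E D; rewrite sin0 => E D cd.
suff : a * (sin x - sin (a * x)) <= (1 - a) * sin (a * x) by lra.
rewrite D; have -> : sin (a * x) = cos c * (a * x) by lra.
have : 0 <= a * (1 - a) * x * (cos c - cos d).
  by rewrite !mulr_ge0 ?subr_ge0.
by lra.
Qed.

Lemma sin_add_split a l :
  sin (a * l) + sin ((1 - a) * l) =
  2 * sin (l / 2) * cos ((a - 1 / 2) * l).
Proof.
have -> : a * l = l / 2 + (a - 1 / 2) * l by lra.
have -> : (1 - a) * l = l / 2 - (a - 1 / 2) * l by lra.
by rewrite sinD sinB; ring.
Qed.

End trigonometry.

(** * The model sphere *)
Section sphere.
Context {R : realType}.
Implicit Types (u v w : 'rV[R]_3) (p q r : @sphere2 R).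

Lemma dotvC u v : dotv u v = dotv v u.
Proof. by apply: eq_bigr => i _; rewrite mulrC. Qed.

Lemma dotvDl u v w : dotv (u + v) w = dotv u w + dotv v w.
Proof.
by rewrite /dotv -big_split; apply: eq_bigr => i _; rewrite mxE mulrDl.
Qed.

Lemma dotvZl (c : R) u v : dotv (c *: u) v = c * dotv u v.
Proof. by rewrite /dotv mulr_sumr; apply: eq_bigr => i _; rewrite mxE mulrA. Qed.

Lemma dotv_ge0 u : 0 <= dotv u u.
Proof. by apply: sumr_ge0 => i _; rewrite -expr2 sqr_ge0. Qed.

Lemma dotv_eq0 u : dotv u u = 0 -> u = 0.
Proof.
move=> /eqP; rewrite psumr_eq0; last by move=> i _; rewrite -expr2 sqr_ge0.
move=> /allP u0; apply/rowP => i; rewrite mxE.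
have := u0 i (mem_index_enum _); rewrite /= mulf_eq0 orbb.
by move/eqP.
Qed.

Lemma dotv_comb (a b c d : R) u v :
  dotv (a *: u + b *: v) (c *: u + d *: v) =
  a * c * dotv u u + (a * d + b * c) * dotv u v + b * d * dotv v v.
Proof.
rewrite dotvDl !dotvZl ![dotv _ (_ + _)]dotvC !dotvDl !dotvZl (dotvC v u).
by ring.
Qed.

Lemma dotv_bound p q : -1 <= dotv (sval p) (sval q) <= 1.
Proof.
have := dotv_ge0 (1 *: sval p + 1 *: sval q).
have := dotv_ge0 (1 *: sval p + (-1) *: sval q).
by rewrite !dotv_comb (svalP p) (svalP q); lra.
Qed.

Lemma sphere2_eq p q : sval p = sval q -> p = q.
Proof.
case: p q => [p pP] [q qP] /= E; subst q.
by congr exist; exact: Prop_irrelevance.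
Qed.

Lemma sphere2_dot1 p q : dotv (sval p) (sval q) = 1 -> p = q.
Proof.
move=> d1; apply: sphere2_eq; apply/eqP; rewrite -subr_eq0; apply/eqP.
apply: dotv_eq0; rewrite -[sval p]scale1r -scaleN1r dotv_comb (svalP p) (svalP q) d1.
by ring.
Qed.

(** Great-circle arcs are geodesics of the rescaled sphere; the second clause
    is the spherical interpolation formula, multiplied by the sine of the
    length so that it also covers the constant arc. *)
Lemma sphere_geodesic (kappa : R) p q :
  0 < kappa -> -1 < dotv (sval p) (sval q) ->
  exists h, geodesic_path (model_dist kappa) h p q /\
    forall s, let l := acos (dotv (sval p) (sval q)) in
      sin l *: sval (h s) = sin (l - Num.sqrt kappa * s) *: sval p +
                            sin (Num.sqrt kappa * s) *: sval q.
Proof.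
move=> kappa0 dgt; have k0 : 0 < Num.sqrt kappa by rewrite sqrtr_gt0.
set k := Num.sqrt kappa in k0 *.
have db := dotv_bound p q.
set l := acos _; have cl : cos l = dotv (sval p) (sval q).
  by apply: acosK; rewrite in_itv.
have l0 : 0 <= l by apply: acos_ge0.
have lpi : l < pi by apply: acos_ltpi; rewrite dgt; case/andP: db.
have [lE|lN] := eqVneq l 0.
  have pq : p = q by apply: sphere2_dot1; rewrite -cl lE cos0.
  exists (fun=> p); split; last first.
    by move=> s /=; rewrite lE sin0 scale0r sub0r sinN pq scaleNr addNr.
  have d0 : model_dist kappa p q = 0 by rewrite /model_dist -/l lE mul0r.
  split=> //; rewrite d0 => s t s0 t0.
  have -> : s = 0 by lra.
  have -> : t = 0 by lra.
  by rewrite subr0 normr0 /model_dist (svalP p) acos1 mul0r.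
have lgt : 0 < l by rewrite lt_neqAle eq_sym lN.
have sl : 0 < sin l by apply: sin_gt0_pi; rewrite lgt.
pose e s := (sin l)^-1 * sin (l - k * s); pose e' s := (sin l)^-1 * sin (k * s).
pose v s : 'rV[R]_3 := e s *: sval p + e' s *: sval q.
have dv s t : dotv (v s) (v t) = cos (k * s - k * t).
  rewrite dotv_comb (svalP p) (svalP q) -cl /e /e' cosB !sinB.
  apply: (@mulfI _ (sin l ^+ 2)); first by rewrite expf_neq0 ?gt_eqF.
  have sE : sin l ^+ 2 = 1 - cos l ^+ 2 by exact: sin2cos2.
  transitivity (sin l ^+ 2 * (cos (k * s) * cos (k * t))
    + (1 - cos l ^+ 2) * (sin (k * s) * sin (k * t))); first by field; rewrite gt_eqF.
  by rewrite -sE; ring.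
have v1 s : dotv (v s) (v s) = 1 by rewrite dv subrr cos0.
exists (fun s => exist _ (v s) (v1 s)); split; last first.
  move=> s /=; rewrite /v scalerDr !scalerA /e /e' !mulrA divff ?gt_eqF//.
  by rewrite !mul1r.
have dl : k * model_dist kappa p q = l.
  by rewrite /model_dist -/l -/k mulrC divfK ?gt_eqF.
split.
- apply: sphere2_eq; rewrite /= /v /e /e' mulr0 subr0 sin0 mulr0 scale0r addr0.
  by rewrite mulVf ?gt_eqF// scale1r.
- apply: sphere2_eq; rewrite /= /v /e /e' dl subrr sin0 mulr0 scale0r add0r.
  by rewrite mulVf ?gt_eqF// scale1r.
- move=> s t /andP[s0 s1] /andP[t0 t1]; rewrite /model_dist /= dv -/k.
  have ks : 0 <= k * s <= l by rewrite -dl !ler_pM2l // mulr_ge0 // ltW.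
  have kt : 0 <= k * t <= l by rewrite -dl !ler_pM2l // mulr_ge0 // ltW.
  rewrite -cos_norm cosK; last first.
    by rewrite in_itv /= normr_ge0 /= ler_norml; lra.
  by rewrite -mulrBr normrM gtr0_norm // mulrC mulKf ?gt_eqF.
Qed.

(** The third vertex is [(cos a, B, sqrt (1 - cos a ^+ 2 - B ^+ 2))], where [B]
    is forced by its distance [b] to the second one; the triangle inequalities
    say exactly that the square root makes sense. *)
Lemma sphere_triangle (l a b : R) :
  0 < l <= pi / 2 -> 0 <= a <= pi / 2 -> 0 <= b <= pi / 2 ->
  a <= l + b -> b <= l + a -> l <= a + b ->
  exists p q r, [/\ dotv (sval p) (sval q) = cos l,
    dotv (sval q) (sval r) = cos b & dotv (sval r) (sval p) = cos a].
Proof.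
move=> /andP[l0 l1] /andP[a0 a1] /andP[b0 b1] hab hba hl.
have sl : 0 < sin l by apply: sin_gt0_pi; have := pi_gt0 R; lra.
have sa : 0 <= sin a by apply: sin_ge0_pi; have := pi_gt0 R; lra.
pose B := (cos b - cos a * cos l) / sin l.
have BE : B * sin l = cos b - cos a * cos l by rewrite /B divfK ?gt_eqF.
have h1 : cos (a + l) <= cos b by apply: cos_anti; lra.
have h2 : cos b <= cos (a - l).
  rewrite -(cos_norm (a - l)); apply: cos_anti; rewrite ?normr_ge0//.
    by rewrite ler_norml; lra.
  by have := pi_gt0 R; lra.
rewrite cosD in h1; rewrite cosB in h2.
have B1 : - sin a <= B.
  by rewrite -(ler_pM2r sl) BE; lra.
have B2 : B <= sin a.
  by rewrite -(ler_pM2r sl) BE; lra.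
have D0 : 0 <= 1 - cos a ^+ 2 - B ^+ 2 by rewrite -sin2cos2; nra.
pose row3 (x y z : R) : 'rV[R]_3 := \row_(j < 3) [:: x; y; z]`_j.
have dE x y z x' y' z' :
    dotv (row3 x y z) (row3 x' y' z') = x * x' + y * y' + z * z'.
  by rewrite /dotv !big_ord_recl big_ord0 !mxE /= addr0 addrA.
have pP : dotv (row3 1 0 0) (row3 1 0 0) = 1 by rewrite dE; ring.
have qP : dotv (row3 (cos l) (sin l) 0) (row3 (cos l) (sin l) 0) = 1.
  by rewrite dE -!expr2 sin2cos2; ring.
pose D := Num.sqrt (1 - cos a ^+ 2 - B ^+ 2).
have rP : dotv (row3 (cos a) B D) (row3 (cos a) B D) = 1.
  by rewrite dE -!expr2 /D sqr_sqrtr //; ring.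
pose mk u (u1 : dotv u u = 1) : @sphere2 R := exist _ u u1.
exists (mk _ pP), (mk _ qP), (mk _ rP); split; rewrite /= dE.
- by ring.
- by rewrite (mulrC (sin l)) BE; ring.
- by ring.
Qed.

End sphere.

(** * The cosine comparison inequality *)

(** Distances measured as central angles of the model sphere. *)
Definition angd {R : realType} (kappa : R) {X : metricType R} (x y : X) : R :=
  Num.sqrt kappa * mdist x y.

(** On the sphere this is an equality, as [g s] is there the combination of [x]
    and [y] with these sines as coefficients, divided by [sin (angd kappa x y)].
    The curvature bound is used only through this form, which is free of
    comparison triangles. *)
Lemma CAT_cos (R : realType) (kappa : R) (X : metricType R) :
  0 < kappa -> CAT kappa X ->
  (forall x y : X, angd kappa x y <= pi / 2) ->
  forall (x y w : X) (g : R -> X) (s : R), geodesic_path mdist g x y ->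
    0 <= s <= mdist x y ->
    sin (angd kappa x y - Num.sqrt kappa * s) * cos (angd kappa x w) +
      sin (Num.sqrt kappa * s) * cos (angd kappa y w) <=
    sin (angd kappa x y) * cos (angd kappa (g s) w).
Proof.
move=> kappa0 [geoX cmpX] small x y w g s gP sP.
set k := Num.sqrt kappa; have k0 : 0 < k by rewrite sqrtr_gt0.
have ang0 (a b : X) : 0 <= angd kappa a b by rewrite mulr_ge0 ?mdist_ge0 // ltW.
have angC (a b : X) : angd kappa a b = angd kappa b a by rewrite /angd metric_sym.
have angT (a b c : X) : angd kappa a c <= angd kappa a b + angd kappa b c.
  by rewrite -mulrDr ler_pM2l // metric_triangle.
have pi0 := pi_gt0 R.
have [l0|lN] := eqVneq (angd kappa x y) 0.
  have d0 : mdist x y = 0.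
    by move/eqP: l0; rewrite mulf_eq0 gt_eqF //= => /eqP.
  have s0 : s = 0 by move: sP; rewrite d0; lra.
  by rewrite l0 s0 mulr0 subr0 sin0 !mul0r addr0.
have l0 : 0 < angd kappa x y by rewrite lt_neqAle eq_sym lN ang0.
have lpi : 0 < angd kappa x y <= pi / 2 by rewrite l0 small.
have angpi (a b : X) : 0 <= angd kappa a b <= pi / 2 by rewrite ang0 small.
have [p [q [r [pq qr rp]]]] : exists p q r : @sphere2 R,
    [/\ dotv (sval p) (sval q) = cos (angd kappa x y),
    dotv (sval q) (sval r) = cos (angd kappa y w) &
    dotv (sval r) (sval p) = cos (angd kappa x w)].
  apply: sphere_triangle => //; first by rewrite (angC x y) angT.
  by rewrite (angC y w) angT.
pose v (i : 'I_3) := nth x [:: x; y; w] i.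
pose pt (i : 'I_3) := nth p [:: p; q; r] i.
have ptE i : dotv (sval (pt i)) (sval (pt (ordS i))) =
    cos (angd kappa (v i) (v (ordS i))).
  case: i => [[|[|[|//]]] ?]; rewrite /v /pt /=.
  - exact: pq.
  - exact: qr.
  - by rewrite angC.
have inpi (a b : X) : angd kappa a b \in `[0, pi].
  by rewrite in_itv /= ang0 /= (le_trans (small _ _)) //; lra.
have ptgt i : -1 < dotv (sval (pt i)) (sval (pt (ordS i))).
  rewrite ptE (@lt_le_trans _ _ 0) ?ltrN10 // cos_ge0_pihalf // small andbT.
  by rewrite (le_trans _ (ang0 _ _)) // oppr_le0; lra.
have [h hP] := choice (fun i => sphere_geodesic kappa0 (ptgt i)).
have [g' g'P] := choice (fun i : 'I_3 => geoX (v i) (v (ordS i))).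
pose G i := if i == ord0 then g else g' i.
have GP : geodesic_triangle mdist v G.
  by move=> i; rewrite /G; case: eqP => [->|_]; [exact: gP|exact: g'P].
have per : perimeter mdist v < 2 * model_diam kappa.
  rewrite /perimeter -(ltr_pM2l k0) mulr_sumr /model_diam.
  have -> : k * (2 * (pi / Num.sqrt kappa)) = 2 * pi :> R.
    by rewrite -/k; field; rewrite gt_eqF.
  have := small (v 0) (v (ordS 0)); have := small (v 1) (v (ordS 1)).
  have := small (v 2%:R) (v (ordS 2%:R)); rewrite /angd -/k.
  rewrite !big_ord_recl big_ord0 /side_length.
  have -> : lift ord0 ord0 = 1 :> 'I_3 by apply/val_inj.
  have -> : lift ord0 (lift ord0 ord0) = 2%:R :> 'I_3 by apply/val_inj.
  by lra.
have sidE i : side_length (model_dist kappa) pt i = side_length mdist v i.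
  rewrite /side_length /model_dist ptE cosK // /angd mulrC -/k.
  by rewrite mulKf ?gt_eqF.
pose i2 := @Ordinal 3 2 isT.
have side0 i : 0 <= side_length mdist v i by exact: mdist_ge0.
have := cmpX v G pt h GP per (fun i => (hP i).1) sidE ord0 i2 s 0 sP.
rewrite lexx side0 => /(_ isT).
have vw : G i2 0 = w by have [-> _ _] := GP i2.
have ptr : h i2 0 = r by have [[-> _ _] _] := hP i2.
have gs : G ord0 s = g s by rewrite /G eqxx.
rewrite vw ptr gs /model_dist -/k ler_pdivlMr // mulrC => main.
have db := dotv_bound (h ord0 s) r.
set d := dotv _ _ in db main.
have cosd : d <= cos (angd kappa (g s) w).
  rewrite -[leLHS](acosK (x := d)) ?in_itv //.
  by apply: cos_anti; rewrite ?ang0 ?acos_lepi.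
have sl : 0 < sin (angd kappa x y).
  by apply: sin_gt0_pi; rewrite l0 /=; have := small x y; lra.
apply: le_trans (ler_wpM2l (ltW sl) cosd).
have /= := (hP ord0).2 s; rewrite ptE /v /= cosK // => E.
by rewrite /d -dotvZl E dotvDl !dotvZl -rp -qr dotvC.
Qed.

(** * Comparison geometry in the cosine form *)
Section comparison.
Context {R : realType} {kappa : R} {X : metricType R}.
Hypothesis kappa0 : 0 < kappa.
Hypothesis catX : CAT kappa X.
Hypothesis small : forall x y : X, angd kappa x y <= pi / 2.

Local Notation A := (angd kappa).
Implicit Types (x y z w u q : X) (a : R).

Lemma sqrt_kappa_gt0 : 0 < Num.sqrt kappa. Proof. by rewrite sqrtr_gt0. Qed.

Lemma angd_ge0 x y : 0 <= A x y.
Proof. by rewrite mulr_ge0 ?mdist_ge0 ?ltW ?sqrt_kappa_gt0. Qed.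

Lemma angdC x y : A x y = A y x. Proof. by rewrite /angd metric_sym. Qed.

Lemma angdxx x : A x x = 0. Proof. by rewrite /angd mdistxx mulr0. Qed.

Lemma angd_triangle y x z : A x z <= A x y + A y z.
Proof. by rewrite -mulrDr ler_pM2l ?sqrt_kappa_gt0 ?metric_triangle. Qed.

Lemma angd_eq0 x y : A x y = 0 -> x = y.
Proof.
move/eqP; rewrite mulf_eq0 gt_eqF ?sqrt_kappa_gt0 //= => /eqP.
exact: mdist_positivity.
Qed.

Lemma angd_pihalf x y : 0 <= A x y <= pi / 2.
Proof. by rewrite angd_ge0 small. Qed.

Lemma angd_pi x y : A x y <= pi.
Proof. by have := small x y; have := pi_gt0 R; lra. Qed.

Lemma cos_angd_ge0 x y : 0 <= cos (A x y).
Proof.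
by apply: cos_ge0_pihalf; have := angd_pihalf x y; have := pi_gt0 R; lra.
Qed.

Lemma sin_angd_gt0 x y : A x y != 0 -> 0 < sin (A x y).
Proof.
move=> n0; apply: sin_gt0_pi; rewrite lt_neqAle eq_sym n0 angd_ge0 /=.
by have := small x y; have := pi_gt0 R; lra.
Qed.

Lemma angd_le_cos x y (l : R) : 0 <= l <= pi -> cos l <= cos (A x y) ->
  A x y <= l.
Proof. by move=> lpi; apply: cos_inj_le; rewrite // angd_ge0 angd_pi. Qed.

Lemma cos_angd_perturb w x y : cos (A y w) - A x y <= cos (A x w).
Proof.
apply: cos_lip; rewrite ?angd_ge0 ?angd_pi //.
by rewrite addrC angd_triangle.
Qed.

Lemma geocombP a x y : 0 <= a <= 1 ->
  [/\ segment x y (geocomb a x y),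
      mdist x (geocomb a x y) = (1 - a) * mdist x y &
      mdist (geocomb a x y) y = a * mdist x y].
Proof.
move=> a01; rewrite /geocomb; set S := (X in xget _ X).
have [g gP] := catX.1 x y; have [g0 g1 gd] := gP.
have d0 := mdist_ge0 x y.
have sP : 0 <= (1 - a) * mdist x y <= mdist x y by case/andP: a01 => *; nra.
apply: (@xgetPex _ x S); exists (g ((1 - a) * mdist x y)); split.
- by exists g, ((1 - a) * mdist x y).
- rewrite -[X in mdist X _ = _]g0 gd ?lexx ?d0 // sub0r normrN ger0_norm //; by case/andP: sP.
- rewrite -[X in mdist _ X = _]g1 gd ?lexx ?d0 // distrC.
  have -> : mdist x y - (1 - a) * mdist x y = a * mdist x y by ring.
  by rewrite ger0_norm // mulr_ge0 //; case/andP: a01.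
Qed.

Lemma angd_comb_l a x y : 0 <= a <= 1 ->
  A x (geocomb a x y) = (1 - a) * A x y.
Proof. by case/(geocombP x y) => _ E _; rewrite /angd E; ring. Qed.

Lemma angd_comb_r a x y : 0 <= a <= 1 ->
  A (geocomb a x y) y = a * A x y.
Proof. by case/(geocombP x y) => _ _ E; rewrite /angd E; ring. Qed.

Lemma comb_cos a x y w : 0 <= a <= 1 ->
  sin (a * A x y) * cos (A x w) + sin ((1 - a) * A x y) * cos (A y w) <=
  sin (A x y) * cos (A (geocomb a x y) w).
Proof.
case/(geocombP x y) => -[g [s [gP sP zE]]] xz _.
have [g0 _ gd] := gP.
have sE : s = (1 - a) * mdist x y.
  rewrite -xz zE -{1}g0 gd ?lexx ?mdist_ge0 // sub0r normrN ger0_norm //.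
  by case/andP: sP.
have := CAT_cos kappa0 catX small w gP sP; rewrite -zE sE /angd.
have -> : Num.sqrt kappa * mdist x y - Num.sqrt kappa * ((1 - a) * mdist x y)
  = a * (Num.sqrt kappa * mdist x y) by ring.
have -> // : Num.sqrt kappa * ((1 - a) * mdist x y)
  = (1 - a) * (Num.sqrt kappa * mdist x y) by ring.
Qed.

Lemma comb_degenerate a x y : 0 <= a <= 1 -> A x y = 0 ->
  y = x /\ geocomb a x y = x.
Proof.
move=> a01 l0; have := angd_comb_l x y a01; rewrite l0 mulr0.
by move/angd_eq0 => <-; split=> //; apply/esym/angd_eq0.
Qed.

Lemma comb_cos_concave a x y w : 0 <= a <= 1 ->
  a * cos (A x w) + (1 - a) * cos (A y w) <= cos (A (geocomb a x y) w).
Proof.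
move=> a01; have := comb_cos x y w a01.
have [l0|lN] := eqVneq (A x y) 0.
  by have [-> ->] := comb_degenerate a01 l0; lra.
have sl := sin_angd_gt0 lN; move=> le1; rewrite -(ler_pM2l sl).
have := sin_concave a01 (angd_pihalf x y).
have a01' : 0 <= 1 - a <= 1 by lra.
have := sin_concave a01' (angd_pihalf x y).
have := cos_angd_ge0 x w; have := cos_angd_ge0 y w.
by nra.
Qed.

(** First-order form of [comb_cos] at the endpoint [y]: on the sphere the
    derivative at [a = 0] of the cosine of the distance to [w] is a positive
    multiple of [cos (A x w) - cos (A y w) * cos (A x y)], and the term
    [- 2 * a] absorbs the second order. *)
Lemma comb_cos_slope a x y w (Y : R) : 0 <= a <= 1 ->
  0 <= Y <= cos (A y w) ->
  let B := cos (A x w) - Y * cos (A x y) - 2 * a in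
  0 <= B -> Y + a * B <= cos (A (geocomb a x y) w).
Proof.
move=> a01 /andP[Y0 Yw] B B0; have := comb_cos x y w a01.
have [l0|lN] := eqVneq (A x y) 0.
  have [_ ->] := comb_degenerate a01 l0.
  have -> : cos (A x w) = B + Y + 2 * a by rewrite /B l0 cos0; ring.
  by case/andP: a01 => *; nra.
have sl := sin_angd_gt0 lN; move=> le1; rewrite -(ler_pM2l sl); move: le1.
case/andP: (a01) => a0 a1; have /andP[l0 lpi] := angd_pihalf x y.
set l := A x y in sl l0 lpi B B0 *; have l2 : l <= 2.
  by have := @pihalf_lt2 R; lra.
set h := a / 2 * l; have h0 : 0 <= h by rewrite /h; nra.
have ha : h <= a by rewrite /h; nra.
have hl : h <= l by rewrite /h; nra.
have -> : a * l = h + h by rewrite /h; field.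
have -> : (1 - a) * l = (l - h) - h by rewrite /h; field.
have slE : sin l = sin ((l - h) + h) by rewrite subrK.
move: slE; rewrite (sinD h) (sinB (l - h)) (sinD (l - h)) => slE.
have ch : 1 - a <= cos h by have := cos_upper h0; nra.
have clh : cos (l - h) - a <= cos l.
  apply: cos_lip => //; first lra.
  - by have := pi_gt0 R; lra.
  - by lra.
  - by have := pi_gt0 R; lra.
have ha2 : a / 2 * sin l <= sin h by apply: sin_concave; rewrite ?l0 //; lra.
have sh0 : 0 <= sin h by apply: sin_ge0_pi; have := pi_gt0 R; lra.
have xw1 := cos_le1 (A x w); have yw1 := cos_le1 (A y w).
have xw0 := cos_angd_ge0 x w.
have inner : B <= cos h * cos (A x w) - cos (l - h) * Y.
  by rewrite /B; nra.
have slh : 0 <= sin (l - h) * cos h - cos (l - h) * sin h.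
  rewrite -sinB; apply: sin_ge0_pi; have := pi_gt0 R.
  by rewrite /h; nra.

move=> le1.
have le2 : (sin (l - h) * cos h - cos (l - h) * sin h) * Y <=
           (sin (l - h) * cos h - cos (l - h) * sin h) * cos (A y w).
  by apply: ler_wpM2l.
have le3 : 2 * sin h * B <= 2 * sin h * (cos h * cos (A x w) - cos (l - h) * Y).
  by apply: ler_wpM2l => //; lra.
have le4 : a * sin l * B <= 2 * sin h * B by apply: ler_wpM2r => //; lra.
have -> : sin l * (Y + a * B) = sin l * Y + a * sin l * B by ring.
rewrite [X in X * Y]slE.
by lra.
Qed.

(** Every nonnegative combination of the unit vectors [x] and [y] is, on the
    sphere, [N] times a unit vector [m] of the arc; in general [m] still
    exists, with an inequality. *)
Lemma comb_cone x y (al be : R) : 0 <= al -> 0 <= be ->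
  exists N m, [/\ 0 <= N,
    N ^+ 2 = al ^+ 2 + be ^+ 2 + 2 * al * be * cos (A x y) &
    forall w, al * cos (A x w) + be * cos (A y w) <= N * cos (A m w)].
Proof.
move=> al0 be0; have [l0|lN] := eqVneq (A x y) 0.
  exists (al + be), x; have [-> _] := comb_degenerate (a := 0) (y := y) (x := x)
    ltac:(lra) l0.
  split; [lra| by rewrite angdxx cos0; ring | by move=> w; lra].
have sl := sin_angd_gt0 lN; have cl0 := cos_angd_ge0 x y.
have /andP[l0 lpi] := angd_pihalf x y.
have s2 := sin2cos2 (A x y).
set l := A x y in sl cl0 lN l0 lpi s2 *.
set Q := al ^+ 2 + be ^+ 2 + 2 * al * be * cos l.
have QE : Q = (be + al * cos l) ^+ 2 + (al * sin l) ^+ 2.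
  by rewrite exprMn s2 /Q; ring.
have Q0 : 0 <= Q by rewrite QE addr_ge0 ?sqr_ge0.
have [Qz|QN] := eqVneq Q 0.
  exists 0, x; split=> //; first by rewrite Qz expr0n.
  have abc : 0 <= al * be * cos l by rewrite !mulr_ge0.
  move: Qz; rewrite /Q => Qz.
  have a2 : al ^+ 2 = 0 by have := sqr_ge0 al; have := sqr_ge0 be; lra.
  have b2 : be ^+ 2 = 0 by have := sqr_ge0 al; have := sqr_ge0 be; lra.
  move/eqP: a2; move/eqP: b2; rewrite !expf_eq0 /= => /eqP -> /eqP -> w.
  by rewrite !mul0r addr0.
have Qgt : 0 < Q by rewrite lt_neqAle eq_sym QN Q0.
pose N := Num.sqrt Q; have N0 : 0 < N by rewrite sqrtr_gt0.
have N2 : N ^+ 2 = Q by rewrite sqr_sqrtr.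
pose r := (be + al * cos l) / N.
have rN : r * N = be + al * cos l by rewrite /r divfK ?gt_eqF.
pose s := al * sin l / N.
have sN : s * N = al * sin l by rewrite /s divfK ?gt_eqF.
have rs : r ^+ 2 + s ^+ 2 = 1.
  apply: (@mulIf _ (N ^+ 2)); first by rewrite expf_neq0 ?gt_eqF.
  by rewrite mulrDl -!exprMn rN sN -QE N2 mul1r.
have s0 : 0 <= s by rewrite /s divr_ge0 ?mulr_ge0 // ltW.
have r1 : -1 <= r <= 1 by have := sqr_ge0 s; nra.
(* [phi] is the angle between [y] and the combination. *)
pose phi := acos r.
have cphi : cos phi = r by apply: acosK; rewrite in_itv.
have phi0 : 0 <= phi by apply: acos_ge0.
have phipi : phi <= pi by apply: acos_lepi.
have sphi : sin phi = s.
  have := sin2cos2 phi; rewrite cphi => E.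
  have sp0 : 0 <= sin phi by apply: sin_ge0_pi; rewrite phi0.
  by apply/eqP; rewrite -(eqrXn2 (n := 2)) //; apply/eqP; lra.
have slphi : sin (l - phi) * N = be * sin l.
  rewrite sinB cphi sphi.
  have -> : (sin l * r - cos l * s) * N = sin l * (r * N) - cos l * (s * N).
    by ring.
  by rewrite rN sN; ring.
have phil : phi <= l.
  rewrite leNgt; apply/negP => lphi.
  have : 0 < sin (phi - l) by apply: sin_gt0_pi; have := pi_gt0 R; lra.
  have -> : phi - l = - (l - phi) by ring.
  rewrite sinN oppr_gt0 -(pmulr_llt0 _ N0) slphi => lt0.
  have : 0 <= be * sin l by rewrite mulr_ge0 // ltW.
  by lra.
have lgt : 0 < l by rewrite lt_neqAle eq_sym lN l0.
pose a := phi / l; have aE : a * l = phi by rewrite /a divfK.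
have a01 : 0 <= a <= 1 by rewrite /a divr_ge0 //= ler_pdivrMr // mul1r.
exists N, (geocomb a x y); split=> //; first exact: ltW.
move=> w; have := comb_cos x y w a01; rewrite -/l aE.
have -> : (1 - a) * l = l - phi by rewrite -aE; ring.
rewrite sphi -(ler_pM2r N0) mulrDl => H; rewrite -(ler_pM2l sl).
have E1 : s * cos (A x w) * N = sin l * (al * cos (A x w)).
  by rewrite mulrAC sN; ring.
have E2 : sin (l - phi) * cos (A y w) * N = sin l * (be * cos (A y w)).
  by rewrite mulrAC slphi; ring.
by move: H; rewrite E1 E2; lra.
Qed.

(** On the sphere this says that twice the inner product of the two vectors
    [al x1 + be y1] and [ga x2 + de y2] is at most the sum of their squared
    lengths.  It is sharp when the weights make the two vectors equal. *)
Lemma four_point x1 y1 x2 y2 (al be ga de : R) :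
  0 <= al -> 0 <= be -> 0 <= ga -> 0 <= de ->
  2 * (al * ga * cos (A x1 x2) + al * de * cos (A x1 y2) +
       be * ga * cos (A y1 x2) + be * de * cos (A y1 y2)) <=
  al ^+ 2 + be ^+ 2 + 2 * al * be * cos (A x1 y1) +
  (ga ^+ 2 + de ^+ 2 + 2 * ga * de * cos (A x2 y2)).
Proof.
move=> al0 be0 ga0 de0.
have [N [m [N0 <- mP]]] := comb_cone x1 y1 al0 be0.
have [N' [m' [N'0 <- m'P]]] := comb_cone x2 y2 ga0 de0.
have h1 := m'P x1; have h2 := m'P y1; have h3 := mP m'.
have h4 : N * (N' * cos (A m m')) <= N * N'.
  by rewrite ler_wpM2l // ler_piMr // cos_le1.
have h5 : N' * (al * cos (A x1 m') + be * cos (A y1 m')) <=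
          N' * (N * cos (A m m')) by apply: ler_wpM2l.
have h6 : al * (ga * cos (A x2 x1) + de * cos (A y2 x1)) <=
          al * (N' * cos (A m' x1)) by apply: ler_wpM2l.
have h7 : be * (ga * cos (A x2 y1) + de * cos (A y2 y1)) <=
          be * (N' * cos (A m' y1)) by apply: ler_wpM2l.
rewrite (angdC x1 x2) (angdC x1 y2) (angdC y1 x2) (angdC y1 y2).
rewrite (angdC x1 m') (angdC y1 m') in h5.
have := sqr_ge0 (N - N'); rewrite sqrrB => h8.
by lra.
Qed.

(** The hypotheses say that the angles of [u1 q1 q2] at [q1] and of [u2 q2 q1] at
    [q2] are not acute; then the side [u1 u2] is at least as long as in the
    spherical quadrilateral with two right angles. *)
Lemma two_right_angles u1 u2 q1 q2 :
  cos (A u1 q2) <= cos (A u1 q1) * cos (A q1 q2) ->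
  cos (A u2 q1) <= cos (A u2 q2) * cos (A q1 q2) ->
  cos (A u1 u2) <= sin (A u1 q1) * sin (A u2 q2) +
    cos (A u1 q1) * cos (A u2 q2) * cos (A q1 q2).
Proof.
move=> h1 h2.
have [r1|r1] := eqVneq (A u1 q1) 0.
  rewrite r1 sin0 cos0 !mul0r add0r mul1r.
  by rewrite (angd_eq0 r1) (angdC q1 u2).
have [r2|r2] := eqVneq (A u2 q2) 0.
  by rewrite r2 sin0 cos0 mulr0 add0r mulr1 (angd_eq0 r2).
have s1 := sin_angd_gt0 r1; have s2 := sin_angd_gt0 r2.
have c1 := cos_angd_ge0 u1 q1; have c2 := cos_angd_ge0 u2 q2.
have E1 := sin2cos2 (A u1 q1); have E2 := sin2cos2 (A u2 q2).
set t1 := sin (A u1 q1) in s1 E1 *; set t2 := sin (A u2 q2) in s2 E2 *.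
set k1 := cos (A u1 q1) in c1 E1 h1 *; set k2 := cos (A u2 q2) in c2 E2 h2 *.
(* These weights represent the crossing point of the diagonals [u1 q2] and
   [u2 q1] of the spherical quadrilateral with right angles at [q1] and [q2]. *)
have := @four_point u1 q2 u2 q1 t2 (t1 * k2) t1 (t2 * k1) (ltW s2)
  (mulr_ge0 (ltW s1) c2) (ltW s1) (mulr_ge0 (ltW s2) c1).
rewrite (angdC q2 u2) (angdC q2 q1) -/k1 -/k2.
have w1 : t2 * (t1 * k2) * cos (A u1 q2) <= t2 * (t1 * k2) * (k1 * cos (A q1 q2)).
  by apply: ler_wpM2l; rewrite // !mulr_ge0 // ltW.
have w2 : t1 * (t2 * k1) * cos (A u2 q1) <= t1 * (t2 * k1) * (k2 * cos (A q1 q2)).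
  by apply: ler_wpM2l; rewrite // !mulr_ge0 // ltW.
move=> H; rewrite -(ler_pM2l (mulr_gt0 s1 s2)).
have F : t2 ^+ 2 * (1 - k1 ^+ 2) + t1 ^+ 2 * (1 - k2 ^+ 2) =
    2 * (t1 * t2 * (t1 * t2)) by rewrite -E1 -E2; ring.
have : 2 * (t1 * t2 * cos (A u1 u2)) <=
   t2 ^+ 2 * (1 - k1 ^+ 2) + t1 ^+ 2 * (1 - k2 ^+ 2) +
   2 * (t1 * t2 * (k1 * k2 * cos (A q1 q2))).
  by lra.
by rewrite F mulrDr; lra.
Qed.

End comparison.

(** * Approximate fixed points and the projection onto the fixed point set *)
Section fixed_points.
Context {R : realType} {kappa : R} {C : completeMetricType R}.
Hypothesis kappa0 : 0 < kappa.
Hypothesis catC : CAT kappa C.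
Hypothesis small : forall x y : C, angd kappa x y <= pi / 2.
Variable c0 : R.
Hypothesis c0_gt0 : 0 < c0.
Hypothesis cos_ge : forall x y : C, c0 <= cos (angd kappa x y).

Local Notation A := (@angd R kappa C).
Local Notation A_ge0 := (angd_ge0 kappa0).
Local Notation AC := (angdC (kappa := kappa)).
Local Notation A_triangle := (angd_triangle kappa0).
Local Notation A_pihalf := (angd_pihalf kappa0 small).

(** Cantor's intersection theorem for a family of sets indexed by a positive
    real. *)
Lemma cantor (P : R -> set C) :
  (forall e, 0 < e -> exists x, P e x) ->
  (forall e e', e <= e' -> P e `<=` P e') ->
  (forall e, 0 < e -> exists2 d, 0 < d &
     forall x y, P d x -> P d y -> A x y <= e) ->
  exists q, forall e, 0 < e -> exists2 x, P e x & A x q <= e.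
Proof.
move=> Pex Pmono Pdiam; have k0 := sqrt_kappa_gt0 kappa0.
have [x xP] := choice (fun n => Pex n.+1%:R^-1 (ltac:(by rewrite invr_gt0))).
have xnear e : 0 < e -> \forall n \near \oo, P e (x n).
  move=> e0; have := @near_infty_natSinv_lt R (PosNum e0).
  by apply: filterS => n /ltW /= /Pmono; apply; exact: xP.
have xcauchy : cauchy (x @ \oo).
  apply/cauchyP => e e0.
  have ke0 : 0 < Num.sqrt kappa * e / 2 by rewrite divr_gt0 // mulr_gt0.
  have [d d0 dP] := Pdiam _ ke0.
  have [N _ NP] := xnear _ d0.
  exists (x N); apply: filterS (xnear _ d0) => n nP; rewrite /= ballEmdist /=.
  rewrite -(ltr_pM2l k0); apply: le_lt_trans (dP _ _ (NP N _) nP) _ => //=.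
  by rewrite ltr_pdivrMr // ltr_pMr ?mulr_gt0 // ltr1n.
have /cauchy_cvgP /cvg_ex [q xq] := xcauchy.
exists q => e e0.
have ke0 : 0 < e / Num.sqrt kappa by rewrite divr_gt0.
move/metricType_numDomainType.cvgrPdist_le : xq => /(_ _ ke0) xq.
have [N _ NP] : \forall n \near \oo, P e (x n) /\ mdist q (x n) <= e / Num.sqrt kappa.
  by apply: filterS2 (xnear _ e0) xq.
have [PN qN] := NP N (leqnn N).
by exists (x N) => //; rewrite AC /angd mulrC -ler_pdivlMr.
Qed.

Lemma le0_eps (v : R) (c : R) : (forall e, 0 < e -> v <= c * e) -> v <= 0.
Proof.
move=> h; rewrite leNgt; apply/negP => v0.
have d0 : 0 < `|c| + 1 by rewrite ltr_wpDl.
have := h (v / (`|c| + 1) / 2) (ltac:(by rewrite !divr_gt0)).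
rewrite leNgt => /negP; apply.
apply: (@le_lt_trans _ _ (`|c| * (v / (`|c| + 1) / 2))).
  by rewrite ler_wpM2r ?ler_norm // !divr_ge0 // ltW.
have -> : `|c| * (v / (`|c| + 1) / 2) = v / 2 * (`|c| / (`|c| + 1)).
  by field; rewrite gt_eqF.
have : `|c| / (`|c| + 1) < 1 by rewrite ltr_pdivrMr // mul1r ltrDl.
have : 0 <= `|c| / (`|c| + 1) by rewrite divr_ge0 // ltW.
by nra.
Qed.

Lemma angd_small_eq (x y : C) (c : R) :
  (forall e, 0 < e -> A x y <= c * e) -> x = y.
Proof.
move=> /le0_eps h; apply: (angd_eq0 kappa0); apply/eqP.
by rewrite eq_le h A_ge0.
Qed.

Lemma angd_le_of_cos (x y : C) (e : R) : 0 <= e ->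
  1 - e ^+ 2 / 5 <= cos (A x y) -> A x y <= e.
Proof.
move=> e0 h; have := cos_lower (A_pihalf x y); have := A_ge0 x y => a0 h2.
rewrite -(ler_pXn2r (n := 2)) ?nnegrE //.
by lra.
Qed.

Section nonexpansive_map.
Variable T : C -> C.
Hypothesis Tne : nonexpansive T.

Lemma angd_nonexp x y : A (T x) (T y) <= A x y.
Proof. by rewrite ler_pM2l ?sqrt_kappa_gt0. Qed.

(** The distances of [T z] to [x] and [y] exceed those of [z] by at most the
    displacements of [x] and [y]; as [z] lies between [x] and [y], this forces
    [T z] to be near [z]. *)
Lemma approx_fix_comb a x y (e : R) : 0 <= a <= 1 ->
  A x (T x) <= e -> A y (T y) <= e ->
  1 - 2 * e <= cos (A (geocomb a x y) (T (geocomb a x y))).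
Proof.
move=> a01 xe ye; set z := geocomb a x y.
have e0 : 0 <= e by apply: le_trans (A_ge0 _ _) xe.
have [l0|lN] := eqVneq (A x y) 0.
  have [_ zx] := comb_degenerate kappa0 catC a01 l0.
  have := cos_angd_perturb kappa0 small (T x) x (T x).
  by rewrite /z zx angdxx cos0; lra.
have sl := sin_angd_gt0 kappa0 small lN.
have := comb_cos kappa0 catC small x y (T z) a01; rewrite -/z => main.
have zx := angd_comb_l catC x y a01; have zy := angd_comb_r catC x y a01.
rewrite -/z in zx zy; case/andP: (a01) => a0 a1.
have /andP[l0 lpi] := A_pihalf x y.
set l := A x y in lN sl main zx zy l0 lpi.
have pi0 := pi_gt0 R.
have cx : cos ((1 - a) * l) - e <= cos (A x (T z)).
  apply: cos_lip; rewrite ?A_ge0 ?angd_pi //; first 1 last.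
  - by have := A_triangle (T x) x (T z); have := angd_nonexp x z; rewrite -zx; lra.
  - by nra.
  - by nra.
have cy : cos (a * l) - e <= cos (A y (T z)).
  apply: cos_lip; rewrite ?A_ge0 ?angd_pi //; first 1 last.
  - have := A_triangle (T y) y (T z); have := angd_nonexp y z.
    by rewrite -zy (AC y z); lra.
  - by nra.
  - by nra.
have sa : 0 <= sin (a * l) by apply: sin_ge0_pi; nra.
have sb : 0 <= sin ((1 - a) * l) by apply: sin_ge0_pi; nra.
have slE : sin l = sin (a * l) * cos ((1 - a) * l) + sin ((1 - a) * l) * cos (a * l).
  have {1}-> : l = a * l + (1 - a) * l by ring.
  by rewrite sinD; ring.
have sums : sin (a * l) + sin ((1 - a) * l) <= 2 * sin l.
  rewrite sin_add_split (sin_half l).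
  have : 7/10 <= cos (l / 2) by apply: cos_ge_pi4; lra.
  have : 0 <= sin (l / 2) by apply: sin_ge0_pi; lra.
  have := cos_le1 ((a - 1 / 2) * l).
  by nra.
rewrite -(ler_pM2l sl).
have : sin (a * l) * (cos ((1 - a) * l) - e) <= sin (a * l) * cos (A x (T z)).
  by apply: ler_wpM2l.
have : sin ((1 - a) * l) * (cos (a * l) - e) <= sin ((1 - a) * l) * cos (A y (T z)).
  by apply: ler_wpM2l.
have : e * (sin (a * l) + sin ((1 - a) * l)) <= e * (2 * sin l).
  by apply: ler_wpM2l.
by rewrite (AC z (T z)) (AC (T z) z); lra.
Qed.

Lemma approx_fix_convex (e : R) : 0 < e -> exists2 d, 0 < d &
  forall a x y, 0 <= a <= 1 -> A x (T x) <= d -> A y (T y) <= d ->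
  A (geocomb a x y) (T (geocomb a x y)) <= e.
Proof.
move=> e0; exists (e ^+ 2 / 10); first by rewrite divr_gt0 // exprn_gt0.
move=> a x y a01 xd yd; apply: angd_le_of_cos; first exact: ltW.
by have := approx_fix_comb a01 xd yd; lra.
Qed.

Hypothesis fix_ex : exists p, T p = p.

(** A nearest fixed point [q] to [u] is obtained together with its robustness:
    no almost fixed point is much nearer to [u].  Both come from the points
    that almost maximize [cos (A u x)] among almost fixed points; as their
    midpoints are almost fixed, they accumulate at [q]. *)
Lemma nearest_fixpoint u : exists2 q, T q = q &
  forall e, 0 < e -> exists2 d, 0 < d &
    forall x, A x (T x) <= d -> cos (A u x) <= cos (A u q) + e.
Proof.
(* The supremum of [S] is the limit, as [d] tends to [0], of the supremum of
   [cos (A u x)] over the points displaced by at most [d]. *)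
pose S := [set v : R | forall d, 0 < d ->
  exists2 x, A x (T x) <= d & v <= cos (A u x)].
have [p pT] := fix_ex.
have Sp : S (cos (A u p)).
  by move=> d d0; exists p => //; rewrite pT angdxx ltW.
have Sub : ubound S 1.
  by move=> v /(_ 1 ltr01)[x _] h; apply: le_trans h (cos_le1 _).
have Ssup : has_sup S by split; [exists (cos (A u p))|exists 1].
set s0 := sup S.
have s0c : c0 <= s0.
  by apply: le_trans (cos_ge u p) _; apply: ub_le_sup => //; exists 1.
have approx e d : 0 < e -> 0 < d ->
    exists2 x, A x (T x) <= d & s0 - e <= cos (A u x).
  move=> e0 d0; have [v vS vs] := sup_adherent e0 Ssup.
  have [x xd vx] := vS d d0; exists x => //.
  by rewrite -/s0 in vs; lra.
have near_sup e : 0 < e -> exists2 d, 0 < d &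
    forall x, A x (T x) <= d -> cos (A u x) <= s0 + e.
  move=> e0; apply: contrapT => h.
  have : S (s0 + e).
    move=> d d0; apply: contrapT => h2; apply: h; exists d => // x xd.
    rewrite leNgt; apply/negP => lt; apply: h2; exists x => //; exact: ltW.
  move=> /(ub_le_sup (ex_intro _ 1 Sub)); rewrite -/s0.
  by lra.
pose P e : set C := [set x | A x (T x) <= e /\ s0 - e <= cos (A u x)].
have Pex e : 0 < e -> exists x, P e x.
  by move=> e0; have [x xe xs] := approx e e e0 e0; exists x.
have Pmono e e' : e <= e' -> P e `<=` P e'.
  by move=> ee' x [h1 h2]; split; lra.
have Pdiam e : 0 < e -> exists2 d, 0 < d &
    forall x y, P d x -> P d y -> A x y <= e.
  move=> e0; pose eta := c0 * e ^+ 2 / 40.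
  have eta0 : 0 < eta by rewrite divr_gt0 // mulr_gt0 // exprn_gt0.
  have [d1 d10 d1P] := near_sup _ eta0.
  have [d2 d20 d2P] := approx_fix_convex d10.
  exists (Num.min d2 eta); first by rewrite lt_min d20.
  move=> x y [xT xs] [yT ys].
  pose h : R := 1 / 2; have half01 : 0 <= h <= 1 by rewrite /h; lra.
  have dd2 : Num.min d2 eta <= d2 by rewrite ge_min lexx.
  have dde : Num.min d2 eta <= eta by rewrite ge_min lexx orbT.
  have [l0|lN] := eqVneq (A x y) 0; first by rewrite l0 ltW.
  have mT := d2P h x y half01 (le_trans xT dd2) (le_trans yT dd2).
  have := d1P _ mT; have := comb_cos kappa0 catC small x y u half01.
  have -> : (1 - h) * A x y = A x y / 2 by rewrite /h; field.
  have -> : h * A x y = A x y / 2 by rewrite /h; field.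
  rewrite (AC x u) (AC y u) (AC _ u) (sin_half (A x y)) => m1 m2.
  have /andP[l0 lpi] := A_pihalf x y.
  have lgt : 0 < A x y by rewrite lt_neqAle eq_sym lN.
  have pi0 := pi_gt0 R.
  have sh : 0 < sin (A x y / 2) by apply: sin_gt0_pi; lra.
  have ch : 0 <= cos (A x y / 2) by apply: cos_ge0_pihalf; lra.
  have ch1 := cos_le1 (A x y / 2).
  have cl : cos (A x y / 2) <= 1 - (A x y / 2) ^+ 2 / 5 by apply: cos_lower; lra.
  have m3 : cos (A u x) + cos (A u y) <=
            2 * cos (A x y / 2) * cos (A u (geocomb h x y)).
    by rewrite -(ler_pM2l sh); lra.
  have m4 : cos (A x y / 2) * cos (A u (geocomb h x y)) <=
            cos (A x y / 2) * (s0 + eta) by apply: ler_wpM2l.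
  have m5 : s0 * (1 - cos (A x y / 2)) <= 2 * eta.
    have : 0 <= eta * (1 - cos (A x y / 2)) by rewrite mulr_ge0 ?subr_ge0 // ltW.
    by lra.
  have m6 : c0 * (1 - cos (A x y / 2)) <= s0 * (1 - cos (A x y / 2)).
    by rewrite ler_wpM2r // subr_ge0.
  have m7 : c0 * ((A x y / 2) ^+ 2 / 5) <= c0 * (e ^+ 2 / 20).
    have : c0 * ((A x y / 2) ^+ 2 / 5) <= c0 * (1 - cos (A x y / 2)).
      by rewrite ler_pM2l //; lra.
    by rewrite /eta in m5; lra.
  rewrite ler_pM2l // in m7.
  by rewrite -(ler_pXn2r (n := 2)) ?nnegrE // ?(ltW e0) //; lra.
have [q qP] := cantor Pex Pmono Pdiam.
have qT : T q = q.
  apply/esym; apply: (@angd_small_eq _ _ 3) => e e0.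
  have [x [xT _] xq] := qP e e0.
  have := A_triangle x q (T q); have := A_triangle (T x) x (T q).
  by have := angd_nonexp x q; rewrite (AC q x); lra.
exists q => // e e0.
have s0q : s0 <= cos (A u q).
  rewrite -subr_le0; apply: (@le0_eps _ 2) => d d0.
  have [x [_ xs] xq] := qP d d0.
  have := cos_angd_perturb kappa0 small u q x.
  by rewrite (AC x u) (AC q u) (AC q x); lra.
have [d d0 dP] := near_sup e e0; exists d => // x /dP.
by lra.
Qed.

(** The spherical Pythagorean theorem makes [cos (A u x)] and
    [cos (A u q) * cos (A q x)] equal when the angle at [q] is right. So [q] is
    the foot of the perpendicular from [u] to the fixed point set, in a form
    that extends to almost fixed points. *)
Definition foot u q := T q = q /\ forall e, 0 < e -> exists2 d, 0 < d &
  forall x, A x (T x) <= d -> cos (A u x) <= cos (A u q) * cos (A q x) + e.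

(** Moving from [q] a little towards an almost fixed point [x] stays among the
    almost fixed points, so it does not bring much nearer to [u];
    [comb_cos_slope] turns this into the right angle. *)
Lemma foot_exists u : exists q, foot u q.
Proof.
have [q qT qP] := nearest_fixpoint u; exists q; split=> // e e0.
pose a := Num.min 1 (e / 4).
have a0 : 0 < a by rewrite lt_min ltr01 /= divr_gt0.
have a1 : a <= 1 by rewrite ge_min lexx.
have ae : a <= e / 4 by rewrite ge_min lexx orbT.
have [d1 d10 d1P] := qP (a * e / 2) (ltac:(by rewrite divr_gt0 // mulr_gt0)).
have [d d0 dP] := approx_fix_convex d10; exists d => // x xd.
have a01 : 0 <= a <= 1 by rewrite ltW.
have qd : A q (T q) <= d by rewrite qT angdxx ltW.
have := d1P _ (dP a x q a01 xd qd).
have qu : 0 <= cos (A u q) <= cos (A q u).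
  by rewrite (AC q u) lexx (le_trans (ltW c0_gt0) (cos_ge u q)).
have := @comb_cos_slope _ _ _ kappa0 catC small a x q u _ a01 qu.
rewrite (AC x u) (AC x q) (AC (geocomb _ _ _) u) /=.
set B := cos (A u x) - _ - _ => slope near.
have [B0|B0] := leP 0 B; last by rewrite /B in B0; lra.
have : a * B <= a * (e / 2) by have := slope B0; lra.
by rewrite ler_pM2l // /B; lra.
Qed.

Lemma foot_right u q p : foot u q -> T p = p ->
  cos (A u p) <= cos (A u q) * cos (A q p).
Proof.
move=> [_ qP] pT; rewrite -subr_le0; apply: (@le0_eps _ 1) => e e0.
have [d d0 /(_ p)] := qP e e0.
by rewrite pT angdxx => /(_ (ltW d0)); lra.
Qed.

Lemma foot_nearest u q p : foot u q -> T p = p -> A u q <= A u p.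
Proof.
move=> uq pT; apply: angd_le_cos; rewrite ?A_ge0 ?angd_pi //.
apply: le_trans (foot_right uq pT) _.
by rewrite ler_piMr ?cos_le1 // (le_trans (ltW c0_gt0)).
Qed.

Lemma foot_metric_proj u q : foot u q -> metric_proj (fixpts T) u = q.
Proof.
move=> uq; have k0 := sqrt_kappa_gt0 kappa0; have qT := uq.1.
have mle p : T p = p -> mdist u q <= mdist u p.
  by move/(foot_nearest uq); rewrite ler_pM2l.
have dE : dist_to u (fixpts T) = mdist u q.
  apply/eqP; rewrite eq_le; apply/andP; split.
    apply: ge_inf; last by exists q.
    by exists 0 => _ [p _ <-]; exact: mdist_ge0.
  apply: lb_le_inf; first by exists (mdist u q), q.
  by move=> _ [p pT <-]; exact: mle.
apply: xget_unique; first by split.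
move=> p [pT]; rewrite dE => pE.
have := foot_right uq pT; rewrite {1}/angd pE -/(angd kappa u q) => h.
apply: (@angd_small_eq _ _ 1) => e e0; rewrite mul1r.
apply: angd_le_of_cos; first exact: ltW.
have c1 : 1 <= cos (A q p).
  rewrite -(ler_pM2l (lt_le_trans c0_gt0 (cos_ge u q))) mulr1.
  exact: h.
by rewrite (AC p q); have := sqr_ge0 e; lra.
Qed.

End nonexpansive_map.
End fixed_points.

(** * The viscosity fixed point *)
Section viscosity.
Context {R : realType} {kappa : R} {C : completeMetricType R}.
Hypothesis kappa0 : 0 < kappa.
Hypothesis catC : CAT kappa C.
Hypothesis small : forall x y : C, angd kappa x y <= pi / 2.
Variable c0 : R.
Hypothesis c0_gt0 : 0 < c0.
Hypothesis cos_ge : forall x y : C, c0 <= cos (angd kappa x y).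
Variables T f : C -> C.
Hypothesis Tne : nonexpansive T.
Hypothesis fix_ex : exists p, T p = p.
Hypothesis f_half : forall x y, angd kappa (f x) (f y) <= angd kappa x y / 2.
Hypothesis f_fix : forall p, T p = p -> angd kappa p (f p) <= pi / 8.

Local Notation A := (@angd R kappa C).
Local Notation A_ge0 := (angd_ge0 kappa0).
Local Notation AC := (angdC (kappa := kappa)).
Local Notation A_triangle := (angd_triangle kappa0).
Local Notation A_pihalf := (angd_pihalf kappa0 small).
Local Notation foot := (foot (kappa := kappa) T).

(** In positive curvature the projection onto a convex set may expand distances.
    Comparison with the quadrilateral with right angles at [q1] and [q2] bounds
    the expansion by about [1 / cos r] at distance [r] from the set; the
    constant [9 / 5] is rough, but suffices for maps that halve distances. *)
Lemma foot_lipschitz u1 u2 q1 q2 : foot u1 q1 -> foot u2 q2 ->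
  A u1 q1 <= pi / 8 -> A u2 q2 <= pi / 8 -> A q1 q2 <= 9 / 5 * A u1 u2.
Proof.
move=> f1 f2 r1 r2.
have h1 := foot_right f1 f2.1; have h2 := foot_right f2 f1.1.
rewrite (AC q2 q1) in h2.
have := two_right_angles kappa0 catC small h1 h2.
have D0 := A_ge0 u1 u2; have := cos_upper D0.
have c1 := @cos_ge_pi8 R (A u1 q1); rewrite A_ge0 r1 in c1.
have c2 := @cos_ge_pi8 R (A u2 q2); rewrite A_ge0 r2 in c2.
have {}c1 := c1 isT; have {}c2 := c2 isT.
have := cos_le1 (A u1 q1 - A u2 q2); rewrite cosB.
have L0 := A_ge0 q1 q2; have := cos_lower (A_pihalf q1 q2).
have X1 := cos_le1 (A q1 q2).
move: (cos (A u1 u2)) (cos (A q1 q2)) (cos (A u1 q1)) (cos (A u2 q2)) X1 c1 c2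
  => cD X k1 k2 X1 c1 c2 g1 g2 g3 g4.
have kk : 8/10 <= k1 * k2 by nra.
have g5 : (8/10) * (1 - X) <= k1 * k2 * (1 - X) by rewrite ler_wpM2r // subr_ge0.
have L9 : 0 <= 9 / 5 * A u1 u2 by lra.
rewrite -(ler_pXn2r (n := 2)) ?nnegrE //.
have := sqr_ge0 (A u1 u2).
by lra.
Qed.

Lemma foot_f_near p q : T p = p -> foot (f p) q -> A (f p) q <= pi / 8.
Proof.
move=> pT fq; apply: le_trans (f_fix pT); rewrite (AC p).
exact: (foot_nearest kappa0 small c0_gt0 cos_ge fq pT).
Qed.

Lemma foot_f_contraction p p' q q' : T p = p -> T p' = p' ->
  foot (f p) q -> foot (f p') q' -> A q q' <= 9 / 10 * A p p'.
Proof.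
move=> pT pT' fq fq'.
have r := foot_f_near pT fq; have r' := foot_f_near pT' fq'.
by have := foot_lipschitz fq fq' r r'; have := f_half p p'; lra.
Qed.

Lemma viscosity_unique q q' : T q = q -> T q' = q' -> foot (f q) q ->
  foot (f q') q' -> q = q'.
Proof.
move=> qT qT' fq fq'; apply: (angd_eq0 kappa0).
have := foot_f_contraction qT qT' fq fq'; have := A_ge0 q q'.
by lra.
Qed.

Lemma viscosity_exists : exists q, foot (f q) q.
Proof.
have [P PP] := choice (foot_exists kappa0 catC small c0_gt0 cos_ge Tne fix_ex).
pose g p := P (f p).
have gT p : T (g p) = g p by have [] := PP (f p).
have gc p p' : T p = p -> T p' = p' -> A (g p) (g p') <= 9 / 10 * A p p'.
  by move=> pT pT'; apply: (foot_f_contraction pT pT').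
pose Q e : set C := [set p | T p = p /\ A p (g p) <= e].
have [p0 p0T] := fix_ex.
have iterT n : T (iter n g p0) = iter n g p0 by case: n => [|n] //=.
have iterA n : A (iter n g p0) (g (iter n g p0)) <= (9 / 10) ^+ n * 2.
  elim: n => [|n IH]; first by rewrite expr0 mul1r; apply: le_trans (small _ _) _;
    exact/ltW/pihalf_lt2.
  rewrite exprS; apply: le_trans (gc _ _ (iterT n) (gT _)) _.
  by rewrite -[leRHS]mulrA ler_wpM2l //; lra.
have Qex e : 0 < e -> exists p, Q e p.
  move=> e0; have r1 : `|9 / 10 : R| < 1 by rewrite ger0_norm //; lra.
  have [|N _ NP] := @cvgr0_norm_le _ _ _ _ _ _ (cvg_expr r1) (e / 2).
    by rewrite divr_gt0.
  exists (iter N g p0); split; first exact: iterT.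
  apply: le_trans (iterA N) _; have := NP N (leqnn N).
  by rewrite /= ger0_norm ?exprn_ge0 //; lra.
have Qmono e e' : e <= e' -> Q e `<=` Q e'.
  by move=> ee' p [pT pe]; split => //; exact: le_trans pe ee'.
have Qdiam e : 0 < e -> exists2 d, 0 < d &
    forall x y, Q d x -> Q d y -> A x y <= e.
  move=> e0; exists (e / 20); first by rewrite divr_gt0.
  move=> x y [xT xg] [yT yg]; have := gc x y xT yT.
  have := A_triangle (g x) x y; have := A_triangle (g y) (g x) y.
  by rewrite (AC (g y) y); lra.
have [q qP] := cantor kappa0 Qex Qmono Qdiam.
have qT : T q = q.
  apply: (@angd_small_eq _ _ _ kappa0 _ _ 2) => e e0; have [x [xT _] xq] := qP e e0.
  have := A_triangle x (T q) q; have := angd_nonexp kappa0 Tne q x.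
  by rewrite xT (AC q x); lra.
exists q; suff gq : g q = q by rewrite -{2}gq; exact: PP.
apply: (@angd_small_eq _ _ _ kappa0 _ _ 3) => e e0; have [x [xT xg] xq] := qP e e0.
have := A_triangle x (g q) q; have := A_triangle (g x) (g q) x.
have := gc q x qT xT; rewrite (AC (g x) x) (AC q x).
by have := A_ge0 x q; lra.
Qed.

Section step.
Variable q : C.
Hypothesis fq : foot (f q) q.

(** On the sphere the right-hand side is
    [sin (A x q) * sin (A x (f x)) * cos g], with [g] the angle at [x] between
    [q] and [f x].  Up to the error made by replacing [f x] by [f q], it is at
    least [cos (A (f q) q) * sin (A x q) ^+ 2], since [q] is the foot of
    [f q].  That error is controlled by [four_point] for the diagonals
    [q, f x] and [x, f q]. *)
Lemma viscosity_angle (e : R) : 0 < e -> exists2 d, 0 < d &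
  forall x, A x (T x) <= d ->
  7 / 100 * (1 - cos (A x q)) - e <=
  cos (A q (f x)) - cos (A x q) * cos (A x (f x)).
Proof.
move=> e0; have [d d0 dP] := fq.2 e e0; exists d => // x /dP.
set u := f q; set z := f x; rewrite (AC q x) => ux.
have ru : 92 / 100 <= cos (A u q).
  by apply: cos_ge_pi8; rewrite A_ge0 /=; apply: foot_f_near fq; exact: fq.1.
have [D0|DN] := eqVneq (A x q) 0.
  by rewrite /z D0 cos0 (angd_eq0 kappa0 D0) /=; lra.
have sD := sin_angd_gt0 kappa0 small DN.
have /andP[D0 Dpi] := A_pihalf x q.
have Dgt : 0 < A x q by rewrite lt_neqAle eq_sym DN D0.
have s2 := sin2cos2 (A x q); have X0 := cos_angd_ge0 kappa0 small x q.
have X1 := cos_le1 (A x q).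
have jord := sin_jordan (A_pihalf x q).
have zu : 1 - (A x q / 2) ^+ 2 / 2 <= cos (A z u).
  apply: le_trans (cos_upper (A_ge0 z u)).
  have : A z u ^+ 2 <= (A x q / 2) ^+ 2.
    by rewrite ler_pXn2r ?nnegrE ?A_ge0 ?divr_ge0 ?f_half.
  by lra.
set D := A x q in DN sD D0 Dpi Dgt s2 X0 X1 jord zu ux *.
(* The weight that balances the two squares in [four_point]: it makes
   [la ^+ 2] times the bound [D ^+ 2 / 8] for [1 - cos (A z u)] equal to
   [sin D ^+ 2 / 2]. *)
pose la := 2 * sin D / D; have la0 : 0 < la by rewrite /la divr_gt0 // mulr_gt0.
have laD : la * D = 2 * sin D by rewrite /la divfK.
have := four_point kappa0 catC small q z x u ler01 (ltW la0) X0 (ltW la0).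
rewrite (AC q x) -/D (AC z x) (AC q u) (AC x u) !mul1r => F.
have laz : la ^+ 2 * (1 - (D / 2) ^+ 2 / 2) <= la ^+ 2 * cos (A z u).
  by rewrite ler_wpM2l // sqr_ge0.
have laE : la ^+ 2 * ((D / 2) ^+ 2 / 2) = sin D ^+ 2 / 2.
  have -> : la ^+ 2 * ((D / 2) ^+ 2 / 2) = (la * D) ^+ 2 / 8 by field.
  by rewrite laD; field.
have la1 : la * (cos D * cos (A u x)) <=
           la * (cos D * (cos (A u q) * cos D + e)).
  by rewrite ler_pM2l // ler_wpM2l.
have G : la * (cos (A u q) * (1 - cos D ^+ 2) - e) - sin D ^+ 2 <=
         la * (cos (A q z) - cos D * cos (A x z)).
  have : la * (cos D * e) <= la * e by rewrite ler_pM2l // ler_piMl // ltW.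
  by lra.
have H : (cos (A u q) * (1 - cos D ^+ 2) - e) - D * sin D / 2 <=
         cos (A q z) - cos D * cos (A x z).
  rewrite -(ler_pM2l la0).
  have -> : la * (cos (A u q) * (1 - cos D ^+ 2) - e - D * sin D / 2) =
     la * (cos (A u q) * (1 - cos D ^+ 2) - e) - la * D * sin D / 2 by field.
  by rewrite laD; move: G; lra.
have K : D * sin D / 2 <= 85 / 100 * sin D ^+ 2.
  have : D * sin D <= (17 / 10 * sin D) * sin D by rewrite ler_pM2r //; lra.
  by lra.
have M : 92 / 100 * (1 - cos D ^+ 2) <= cos (A u q) * (1 - cos D ^+ 2).
  by rewrite ler_wpM2r // -s2 sqr_ge0.
have N : 1 - cos D <= 1 - cos D ^+ 2 by nra.
by rewrite s2 in K; lra.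
Qed.

(** The segment from [T x] to [f x] starts at a point at most as far from [q] as
    [x]; by [comb_cos_slope] it approaches [q] at a rate that [viscosity_angle]
    bounds below, up to the displacement of [x]. *)
Lemma step_attract (e be : R) : 0 < e -> 0 < be -> exists2 d, 0 < d &
  forall x t b, A x (T x) <= d -> 0 <= t <= d -> 0 <= b <= 1 - be ->
  let y := geocomb t (f x) (T x) in
  e <= 1 - cos (A x q) ->
  cos (A x q) + be * (4 / 100 * e) * t <= cos (A (geocomb b x y) q).
Proof.
move=> e0 be0; have e1 : 0 < e / 100 by rewrite divr_gt0.
have [d1 d10 d1P] := viscosity_angle e1.
pose d := Num.min (Num.min d1 1) (e / 200).
have d0 : 0 < d by rewrite !lt_min d10 ltr01 divr_gt0.
have dd1 : d <= d1 by rewrite !ge_min lexx.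
have dle1 : d <= 1 by rewrite !ge_min lexx orbT.
have de : d <= e / 200 by rewrite !ge_min lexx !orbT.
exists d => // x t b xd /andP[t0 td] /andP[b0 b1] y ex.
have t01 : 0 <= t <= 1 by lra.
have b01 : 0 <= b <= 1 by lra.
have qT := fq.1.
have X0 := cos_angd_ge0 kappa0 small x q; have X1 := cos_le1 (A x q).
have XT : 0 <= cos (A x q) <= cos (A (T x) q).
  rewrite X0 /=; apply: cos_anti; rewrite ?A_ge0 ?angd_pi //.
  by rewrite -[X in A _ X]qT; exact: angd_nonexp.
have := d1P x (le_trans xd dd1); rewrite (AC q (f x)) (AC x (f x)) => ang.
have := @comb_cos_slope _ _ _ kappa0 catC small t (f x) (T x) q _ t01 XT.
rewrite /= -/y => slope.
have p1 := cos_angd_perturb kappa0 small (f x) x (T x).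
rewrite (AC (T x)) (AC x (f x)) in p1.
have p2 : cos (A x q) * (cos (A (f x) (T x)) - A x (T x)) <=
          cos (A x q) * cos (A (f x) x) by rewrite ler_wpM2l.
have p3 : cos (A x q) * A x (T x) <= A x (T x) by rewrite ler_piMl ?A_ge0.
set B := cos (A (f x) q) - _ - _ in slope.
have B1 : 4 / 100 * e <= B by rewrite /B; lra.
have yq : cos (A x q) + t * (4 / 100 * e) <= cos (A y q).
  apply: le_trans (slope _); last by lra.
  by rewrite lerD2l ler_wpM2l.
have := comb_cos_concave kappa0 catC small x y q b01.
have : (1 - b) * (cos (A x q) + t * (4 / 100 * e)) <= (1 - b) * cos (A y q).
  by rewrite ler_wpM2l //; lra.
have : be * (t * (4 / 100 * e)) <= (1 - b) * (t * (4 / 100 * e)).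
  by rewrite ler_wpM2r ?mulr_ge0 //; lra.
by lra.
Qed.

(** Averaging [x] and [y] gains the square of their distance, as in the
    parallelogram law. *)
Lemma step_average x t b : 0 <= t <= 1 -> 0 <= b <= 1 ->
  let y := geocomb t (f x) (T x) in
  cos (A x q) + c0 * (b * (1 - b) * A x y ^+ 2 / 8) - 2 * t <=
    cos (A (geocomb b x y) q)
  /\ A x (T x) <= A x y + 2 * t.
Proof.
move=> t01 b01 y; have qT := fq.1; case/andP: (t01) => t0 t1.
have yT : A y (T x) <= 2 * t.
  rewrite (angd_comb_r catC) // (mulrC 2) ler_wpM2l //.
  by apply: le_trans (small _ _) _; exact/ltW/pihalf_lt2.
split; last by have := A_triangle y x (T x); lra.
have XT : cos (A x q) <= cos (A (T x) q).
  apply: cos_anti; rewrite ?A_ge0 ?angd_pi //.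
  by rewrite -[X in A _ X]qT; exact: angd_nonexp.
have yq : cos (A x q) - 2 * t <= cos (A y q).
  by have := cos_angd_perturb kappa0 small q y (T x); lra.
have X0 := cos_ge x q; have X1 := cos_le1 (A x q).
have [l0|lN] := eqVneq (A x y) 0.
  have [_ ->] := comb_degenerate kappa0 catC b01 l0.
  by rewrite l0 expr0n /= mulr0 mul0r mulr0; lra.
have sl := sin_angd_gt0 kappa0 small lN.
have := comb_cos kappa0 catC small x y q b01.
have /andP[l0 lpi] := A_pihalf x y.
set l := A x y in lN sl l0 lpi *; move=> main; case/andP: (b01) => b0 b1.
have pi0 := pi_gt0 R.
rewrite -(ler_pM2l sl); apply: le_trans main.
set al := b * (l / 2); set be := (1 - b) * (l / 2).
have half2 : 0 <= l / 2 <= pi / 2 by lra.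
have b01' : 0 <= 1 - b <= 1 by lra.
have sh : l / 4 <= sin (l / 2) by have := sin_jordan half2; lra.
have sal : b * (l / 4) <= sin al.
  by apply: (le_trans _ (sin_concave b01 half2)); rewrite ler_wpM2l.
have sbe : (1 - b) * (l / 4) <= sin be.
  by apply: (le_trans _ (sin_concave b01' half2)); rewrite ler_wpM2l //; lra.
have prod : b * (1 - b) * l ^+ 2 / 16 <= sin al * sin be.
  have -> : b * (1 - b) * l ^+ 2 / 16 = (b * (l / 4)) * ((1 - b) * (l / 4)).
    by field.
  have l4 : 0 <= l / 4 by lra.
  by apply: ler_pM => //; rewrite mulr_ge0 // subr_ge0.
have prod0 : 0 <= b * (1 - b) * l ^+ 2 / 16.
  have b1b : 0 <= b * (1 - b) by rewrite mulr_ge0 // subr_ge0.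
  by have := mulr_ge0 b1b (sqr_ge0 l); lra.
have sum : sin l + 2 * sin l * (sin al * sin be) <=
           sin (b * l) + sin ((1 - b) * l).
  rewrite sin_add_split (sin_half l).
  have -> : (b - 1 / 2) * l = al - be by rewrite /al /be; field.
  have {2 4}-> : l / 2 = al + be by rewrite /al /be; ring.
  rewrite cosB cosD.
  have c1 := cos_le1 (al + be); have s0 : 0 <= sin (l / 2) by lra.
  have ss0 := le_trans prod0 prod.
  have : 0 <= 2 * sin (l / 2) * (sin al * sin be) * (2 - 2 * cos (al + be)).
    by apply: mulr_ge0; [apply: mulr_ge0 => //; rewrite mulr_ge0|lra].
  by rewrite cosD; lra.
have sb : 0 <= sin (b * l) by apply: sin_ge0_pi; nra.
have sb1 : 0 <= sin ((1 - b) * l) by apply: sin_ge0_pi; nra.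
have sb2 : sin ((1 - b) * l) <= sin l by apply: sin_mono; nra.
have m1 : sin ((1 - b) * l) * (cos (A x q) - 2 * t) <=
          sin ((1 - b) * l) * cos (A y q) by rewrite ler_wpM2l.
have m2 : 2 * t * sin ((1 - b) * l) <= 2 * t * sin l.
  by rewrite ler_wpM2l // mulr_ge0.
have m3 : cos (A x q) * (sin l + 2 * sin l * (sin al * sin be)) <=
          cos (A x q) * (sin (b * l) + sin ((1 - b) * l)).
  by rewrite ler_wpM2l // (le_trans (ltW c0_gt0) X0).
have m4 : c0 * (2 * sin l * (b * (1 - b) * l ^+ 2 / 16)) <=
          cos (A x q) * (2 * sin l * (sin al * sin be)).
  apply: ler_pM => //; [exact: ltW| |by rewrite ler_wpM2l // mulr_ge0 // ltW].
  by rewrite mulr_ge0 // mulr_ge0 // ltW.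
by lra.
Qed.

End step.
End viscosity.

(** * Sequences *)
Section sequences.
Context {R : realType}.
Implicit Types (s t b : nat -> R).

Lemma limn_esup_lt_near b (c : R) : (limn_esup (EFin \o b) < c%:E)%E ->
  exists2 r, r < c & \forall n \near \oo, b n <= r.
Proof.
rewrite /limn_esup /limf_esup => /ereal_inf_lt [_ [V Voo <-]] Vc.
have [N _ NV] := Voo.
have ub n : (N <= n)%N -> ((b n)%:E <= ereal_sup ((EFin \o b) @` V))%E.
  by move=> Nn; apply: ereal_sup_ubound; exists n => //; exact: NV.
move: Vc ub; case: (ereal_sup _) => [r| |] // rc ub.
  by exists r; [rewrite lte_fin in rc|exists N => // n /ub; rewrite lee_fin].
by have := ub N (leqnn N).
Qed.

Lemma limn_einf_gt_near b (c : R) : (c%:E < limn_einf (EFin \o b))%E ->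
  exists2 r, c < r & \forall n \near \oo, r <= b n.
Proof.
rewrite /limn_einf lteNr => h.
have [r rc rb] : exists2 r, r < - c & \forall n \near \oo, - b n <= r.
  exact: (@limn_esup_lt_near (fun n => - b n)).
exists (- r); first by rewrite ltrNr.
by apply: filterS rb => n; rewrite lerNl.
Qed.

Lemma bounded_series_lty t N (K : R) : (1 <= N)%N ->
  (forall n, (1 <= n)%N -> 0 <= t n) ->
  (forall j, \sum_(N <= i < N + j) t i <= K) ->
  (\sum_(1 <= n <oo) (t n)%:E < +oo)%E.
Proof.
move=> N1 t0 tK.
apply: (@le_lt_trans _ _ (\sum_(1 <= i < N) t i + K)%:E); last exact: ltry.
apply: lime_le.
  by apply: is_cvg_nneseries_cond => n n1 _; rewrite lee_fin t0.
near=> m; rewrite sumEFin lee_fin.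
have Nm : (N <= m)%N by near: m; exists N.
rewrite (@big_cat_nat _ _ _ N) //= lerD2l.
by have := tK (m - N)%N; rewrite subnKC.
Unshelve. all: by end_near. Qed.

(** Above the level [e / 2] the decrease is proportional to [t n], so the
    divergent series brings [s] below [e / 2].  A step from below [e / 2] gains
    at most [2 * t n], which is eventually at most [e / 2], and a step from
    above descends: hence [s] stays below [e]. *)
Lemma divergent_descent s t :
  (forall n, (1 <= n)%N -> 0 <= s n) -> (forall n, (1 <= n)%N -> 0 <= t n) ->
  t @ \oo --> 0 -> (\sum_(1 <= n <oo) (t n)%:E = +oo)%E ->
  (forall n, (1 <= n)%N -> s n.+1 <= s n + 2 * t n) ->
  (forall e, 0 < e -> exists2 g, 0 < g &
     \forall n \near \oo, e <= s n -> s n.+1 <= s n - g * t n) ->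
  forall e, 0 < e -> \forall n \near \oo, s n <= e.
Proof.
move=> s0 t0 tz tsum up down e e0; have e20 : 0 < e / 2 by rewrite divr_gt0.
have e40 : 0 < e / 4 by rewrite divr_gt0.
have [g g0 [N1 _ N1P]] := down _ e20.
have [N2 _ N2P] := @cvgr0_norm_le _ _ _ _ _ _ tz _ e40.
pose N := maxn 1 (maxn N1 N2).
have N_1 : (1 <= N)%N by rewrite leq_maxl.
have NP n : (N <= n)%N -> [/\ (1 <= n)%N, t n <= e / 4 &
    e / 2 <= s n -> s n.+1 <= s n - g * t n].
  rewrite !geq_max => /and3P[n1 nN1 nN2]; split=> //; last exact: N1P.
  by apply: le_trans (ler_norm _) (N2P _ nN2).
have [m Nm sm] : exists2 m, (N <= m)%N & s m < e / 2.
  apply: contrapT => nex.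
  have ge n : (N <= n)%N -> e / 2 <= s n.
    by move=> Nn; rewrite leNgt; apply/negP => lt; apply: nex; exists n.
  have sums j : s (N + j)%N <= s N - g * \sum_(N <= i < N + j) t i.
    elim: j => [|j IH]; first by rewrite addn0 big_geq // mulr0 subr0.
    rewrite addnS big_nat_recr ?leq_addr //=.
    have [_ _ dec] := NP (N + j)%N (leq_addr _ _).
    by have := dec (ge _ (leq_addr _ _)); lra.
  have : (\sum_(1 <= n <oo) (t n)%:E < +oo)%E.
    apply: (@bounded_series_lty t N (s N / g)) => // j.
    rewrite ler_pdivlMr // mulrC.
    by have := s0 (N + j)%N (leq_trans N_1 (leq_addr _ _)); have := sums j; lra.
  by rewrite tsum.
have stay j : s (m + j)%N <= e.
  elim: j => [|j IH]; first by rewrite addn0; lra.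
  have [n1 tn dec] := NP (m + j)%N (leq_trans Nm (leq_addr _ _)).
  rewrite addnS; have [le|lt] := leP (e / 2) (s (m + j)%N).
    by have := dec le; have := mulr_ge0 (ltW g0) (t0 _ n1); lra.
  by have := up _ n1; lra.
by exists m => // n /= mn; rewrite -(subnKC mn).
Qed.

End sequences.

(** * Convergence of the iteration *)
Section convergence.
Context {R : realType} {kappa : R} {C : completeMetricType R}.
Hypothesis kappa0 : 0 < kappa.
Hypothesis catC : CAT kappa C.
Hypothesis small : forall x y : C, angd kappa x y <= pi / 2.
Variable c0 : R.
Hypothesis c0_gt0 : 0 < c0.
Hypothesis cos_ge : forall x y : C, c0 <= cos (angd kappa x y).
Variables T f : C -> C.
Hypothesis Tne : nonexpansive T.
Hypothesis f_half : forall x y, angd kappa (f x) (f y) <= angd kappa x y / 2.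
Hypothesis f_fix : forall p, T p = p -> angd kappa p (f p) <= pi / 8.

Local Notation A := (@angd R kappa C).

(** Applied to [1 - cos (A (x n) q)], the descent lemma asks for a decrease
    away from [q]; it comes from [step_average] when [x n] is far from [y n],
    and from [step_attract] when they are near, as [x n] is then almost fixed. *)
Lemma viscosity_converges q (b t : nat -> R) (x y : nat -> C) (be : R) :
  foot (kappa := kappa) T (f q) q ->
  (forall n, (1 <= n)%N -> 0 < b n < 1 /\ 0 < t n < 1) ->
  0 < be -> (\forall n \near \oo, be <= b n <= 1 - be) ->
  t @ \oo --> 0 -> (\sum_(1 <= n <oo) (t n)%:E = +oo)%E ->
  (forall n, (1 <= n)%N -> y n = geocomb (t n) (f (x n)) (T (x n))) ->
  (forall n, (1 <= n)%N -> x n.+1 = geocomb (b n) (x n) (y n)) ->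
  x @ \oo --> q.
Proof.
move=> fq bt be0 bnear tz tsum yE xE.
have bt01 n : (1 <= n)%N -> (0 <= t n <= 1) /\ (0 <= b n <= 1).
  by move=> /bt [/andP[b0 b1] /andP[t0 t1]]; rewrite !ltW.
have avg n (n1 : (1 <= n)%N) := step_average kappa0 catC small c0_gt0 cos_ge Tne
  fq (x n) (bt01 n n1).1 (bt01 n n1).2.
pose s n := 1 - cos (A (x n) q).
have s_small e : 0 < e -> \forall n \near \oo, s n <= e.
  apply: (divergent_descent (t := t)) => //.
  - by move=> n _; rewrite /s subr_ge0 cos_le1.
  - by move=> n /bt01 [/andP[]].
  - move=> n n1; have [gain _] := avg n n1; move: gain; rewrite /= -yE // -xE //.
    have [/andP[t0 t1] /andP[b0 b1]] := bt01 n n1.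
    have : 0 <= c0 * (b n * (1 - b n) * A (x n) (y n) ^+ 2 / 8).
      rewrite mulr_ge0 ?(ltW c0_gt0) // divr_ge0 //.
      by rewrite mulr_ge0 ?sqr_ge0 // mulr_ge0 // subr_ge0.
    by rewrite /s; lra.
  move=> e1 e10.
  have [d d0 dP] := step_attract kappa0 catC small c0_gt0 cos_ge Tne f_half f_fix
    fq e10 be0.
  exists (Num.min 1 (be * (4 / 100 * e1))).
    by rewrite lt_min ltr01 /= !mulr_gt0.
  set g := Num.min _ _.
  have g1 : g <= 1 by rewrite ge_min lexx.
  have ge : g <= be * (4 / 100 * e1) by rewrite ge_min lexx orbT.
  (* [3 * tau] is at most what averaging gains when [d / 2 <= l]; of this,
     [2 * t n] pays for the drift and [t n] is left as decrease. *)
  pose tau := Num.min (d / 4) (c0 * (be ^+ 2 * (d / 2) ^+ 2 / 8) / 3).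
  have tau0 : 0 < tau.
    rewrite lt_min divr_gt0 //= divr_gt0 // mulr_gt0 // divr_gt0 //.
    by rewrite mulr_gt0 // exprn_gt0 // divr_gt0.
  have taud : tau <= d / 4 by rewrite ge_min lexx.
  have tauc : tau <= c0 * (be ^+ 2 * (d / 2) ^+ 2 / 8) / 3.
    by rewrite ge_min lexx orbT.
  have n1near : \forall n \near \oo, (1 <= n)%N by exists 1%N.
  near=> n => es.
  have n1 : (1 <= n)%N by near: n.
  have /andP[bb bb1] : be <= b n <= 1 - be by near: n.
  have tn : `|t n| <= tau
    by near: n; exact: (@cvgr0_norm_le _ _ _ _ _ _ tz _ tau0).
  have [t01 b01] := bt01 n n1; have /andP[t0 t1] := t01.
  rewrite ger0_norm // in tn.
  have [gain near_fix] := avg n n1; move: gain; rewrite /= -yE // -xE // in near_fix *.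
  set l := A (x n) (y n) in near_fix *; move=> gain.
  have [ld|ld] := leP l (d / 2).
    have xT : A (x n) (T (x n)) <= d by lra.
    have td : 0 <= t n <= d by lra.
    have bbe : 0 <= b n <= 1 - be by lra.
    have := dP (x n) (t n) (b n) xT td bbe es; rewrite -yE // -xE //.
    have : g * t n <= be * (4 / 100 * e1) * t n by rewrite ler_wpM2r.
    by rewrite /s; lra.
  have l2 : (d / 2) ^+ 2 <= l ^+ 2.
    by rewrite ler_pXn2r ?nnegrE ?angd_ge0 // ?divr_ge0 // ltW.
  have bb2 : be ^+ 2 <= b n * (1 - b n).
    by rewrite expr2; apply: ler_pM; rewrite ?(ltW be0) //; lra.
  have gain2 : be ^+ 2 * (d / 2) ^+ 2 <= b n * (1 - b n) * l ^+ 2.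
    by apply: ler_pM => //; exact: sqr_ge0.
  have gain3 : c0 * (be ^+ 2 * (d / 2) ^+ 2 / 8) <=
               c0 * (b n * (1 - b n) * l ^+ 2 / 8).
    by rewrite ler_pM2l // ler_pM2r.
  have : g * t n <= t n by rewrite ler_piMl.
  by rewrite /s; lra.
have k0 := sqrt_kappa_gt0 kappa0.
apply/metricType_numDomainType.cvgrPdist_le => e e0.
have ke0 : 0 < Num.sqrt kappa * e by rewrite mulr_gt0.
have : \forall n \near \oo, s n <= (Num.sqrt kappa * e) ^+ 2 / 5.
  by apply: s_small; rewrite divr_gt0 // exprn_gt0.
apply: filterS => n sn.
have := @angd_le_of_cos _ _ _ kappa0 small (x n) q _ (ltW ke0).
rewrite metric_sym /angd ler_pM2l // -/(angd kappa (x n) q); apply.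
by rewrite /s in sn; lra.
Unshelve. all: by end_near. Qed.

End convergence.

(** * The viscosity theorem *)

Theorem theorem4p2 (R : realType) (kappa : R) (C : completeMetricType R)
    (T f : C -> C) (M k : R) :
  0 < kappa ->
  CAT kappa C ->
  N_property kappa C ->
  (diameter C < (model_diam kappa / 2)%:E)%E ->
  nonexpansive T ->
  fixpts T !=set0 ->
  0 < M < pi / 2 ->
  contraction_with k f ->
  k < 2 * sin (M / 2) ^+ 2 * cos M / M ^+ 2 ->
  (forall p, fixpts T p -> mdist p (f p) <= M / (4 * Num.sqrt kappa)) ->
  exists q : C,
    unique (fun z => fixpts T z /\ metric_proj (fixpts T) (f z) = z) q /\
    forall (u : C) (b t : nat -> R) (x y : nat -> C),
      mdist u q <= M / (4 * Num.sqrt kappa) ->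
      (forall n, (1 <= n)%N -> 0 < b n < 1 /\ 0 < t n < 1) ->
      [/\ (0 < limn_einf (EFin \o b))%E,
          (limn_einf (EFin \o b) <= limn_esup (EFin \o b))%E
        & (limn_esup (EFin \o b) < 1)%E] ->
      t @ \oo --> 0 ->
      (\sum_(1 <= n <oo) (t n)%:E = +oo)%E ->
      x 1%N = u ->
      (forall n, (1 <= n)%N -> y n = geocomb (t n) (f (x n)) (T (x n))) ->
      (forall n, (1 <= n)%N -> x n.+1 = geocomb (b n) (x n) (y n)) ->
      x @ \oo --> q.
Proof.
move=> kappa0 catC _ diam Tne [p0 p0T] /andP[M0 Mpi] [k01 fk] kM fM.
have k0 := sqrt_kappa_gt0 kappa0; have pi0 := pi_gt0 R.
have [de de0 [de1 deP]] : exists2 de, 0 <= de &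
    de < pi / 2 /\ forall x y : C, angd kappa x y <= de.
  have ub (x y : C) : ((mdist x y)%:E <= diameter C)%E.
    by apply: ereal_sup_ubound; exists (x, y).
  move: diam ub; case: (diameter C) => [d| |] // diam ub; last first.
    by have := ub p0 p0.
  exists (Num.sqrt kappa * d).
    by rewrite mulr_ge0 // ?(ltW k0) //; have := ub p0 p0; rewrite lee_fin mdistxx.
  split; last by move=> x y; rewrite ler_pM2l // -lee_fin.
  move: diam; rewrite lte_fin /model_diam -(ltr_pM2l k0).
  by have -> : Num.sqrt kappa * (pi / Num.sqrt kappa / 2) = pi / 2;
    first by field; rewrite gt_eqF.
have small (x y : C) : angd kappa x y <= pi / 2 by have := deP x y; lra.
have c0_gt0 : 0 < cos de by apply: cos_gt0_pihalf; lra.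
have cos_ge (x y : C) : cos de <= cos (angd kappa x y).
  by apply: cos_anti; rewrite ?angd_ge0 //; lra.
have k_half : k <= 1 / 2.
  apply: (le_trans (ltW kM)); rewrite ler_pdivrMr ?exprn_gt0 //.
  have M2 : 0 <= M / 2 by lra.
  have s0 : 0 <= sin (M / 2) by apply: sin_ge0_pi; lra.
  have s2 : sin (M / 2) ^+ 2 <= (M / 2) ^+ 2.
    by rewrite ler_pXn2r ?nnegrE // sin_lex.
  have : sin (M / 2) ^+ 2 * cos M <= sin (M / 2) ^+ 2.
    by rewrite ler_piMr ?sqr_ge0 ?cos_le1.
  by lra.
have f_half (x y : C) : angd kappa (f x) (f y) <= angd kappa x y / 2.
  rewrite /angd -mulrA ler_pM2l //; apply: le_trans (fk x y) _.
  by rewrite mulrC ler_wpM2l ?mdist_ge0 //; lra.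
have f_fix p : T p = p -> angd kappa p (f p) <= pi / 8.
  move=> pT; apply: (@le_trans _ _ (M / 4)); last by lra.
  have -> : M / 4 = Num.sqrt kappa * (M / (4 * Num.sqrt kappa)).
    by field; rewrite gt_eqF.
  by rewrite ler_pM2l // fM.
have fix_ex : exists p, T p = p by exists p0.
have [q fq] := viscosity_exists kappa0 catC small c0_gt0 cos_ge Tne fix_ex
  f_half f_fix.
have proj := foot_metric_proj kappa0 small c0_gt0 cos_ge.
exists q; split.
  split; first by split; [exact: fq.1|exact: proj].
  move=> z [zT zP]; have [z' fz'] := foot_exists kappa0 catC small c0_gt0 cos_ge
    Tne fix_ex (f z).
  have zz' : z' = z by rewrite -zP (proj _ _ _ fz').
  rewrite zz' in fz'.
  exact: (viscosity_unique kappa0 catC small c0_gt0 cos_ge f_half f_fix fq.1 zT fq fz').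
move=> u b t x y _ bt [b_inf _ b_sup] tz tsum _ yE xE.
have [r1 r10 r1b] := limn_einf_gt_near b_inf.
have [r2 r21 r2b] := limn_esup_lt_near b_sup.
apply: (viscosity_converges kappa0 catC small c0_gt0 cos_ge Tne f_half f_fix
  (be := Num.min r1 (1 - r2)) fq bt _ _ tz tsum yE xE).
  by rewrite lt_min r10 subr_gt0.
apply: filterS2 r1b r2b => n n1 n2; rewrite ge_min n1 /=.
have : Num.min r1 (1 - r2) <= 1 - r2 by rewrite ge_min lexx orbT.
by lra.
Qed.
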